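(* Let $\ell:\mathbb{N}\to\mathbb{N}$ satisfy $\ell(n)=o\!\left(\frac{n}{\log n}\right)$. Then, for any $\ell$-index-based pivot rule $\Pi^{P}$, there exists a family $(\mathrm{LP}_n)_{n\in\mathbb{N}}$ of linear programs, where $\mathrm{LP}_n$ has $n$ variables and $m\le n$ equality constraints, such that the simplex method with pivot rule $\Pi^{P}$ requires $n^{\omega(1)}$ (i.e. superpolynomially many in $n$) iterations to find the optimal basis.
   Context: Linear programs are of the form $\max\, c^\top x$ s.t. $Ax=b$, $x\ge 0$, with $A\in\mathbb{Q}^{m\times n}$ of full row rank, $b\in\mathbb{Q}^m$, $c\in\mathbb{Q}^n$; they are assumed feasible and bounded, and the simplex method is given an initial feasible basis. A basis is a set $B\subseteq[n]=\{1,\dots,n\}$ of $m$ indices of linearly independent columns of $A$; it is feasible if the unique $x$ with $Ax=b$ and $x_i=0$ for $i\notin B$ satisfies $x\ge0$. The reduced cost of $i$ is $\mathrm{rc}(i)=c_i-c_B^\top A_{\cdot B}^{-1}A_{\cdot i}$, and $\Gamma^+(B)=\{i\in[n]\setminus B:\mathrm{rc}(i)>0\}$ is the set of improving indices. An iteration of the simplex method picks an entering index $i\in\Gamma^+(B)$ and a leaving index $j\in B$ such that $B\cup\{i\}\setminus\{j\}$ is a feasible basis and moves to it; it stops at a basis with $\Gamma^+(B)=\emptyset$ (optimal basis). In non-degenerate programs the leaving index is uniquely determined by the entering index. Given $\ell:\mathbb{N}\to\mathbb{N}$, an $\ell$-index-selector function is a function $P:\mathbb{N}^3\to\mathbb{N}^2$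 with $P(k,n,h)\in\{1,\dots,k\}\times\{1,\dots,\ell(n)\}$ for all $k,n,h$. It induces the $\ell$-index-based pivot rule $\Pi^P$, which has memory states $\{1,\dots,\ell(n)\}$, starts in memory state $1$, and acts as follows: on a program with $n$ variables at feasible non-optimal basis $B$ in memory state $h$, if $P(|\Gamma^+(B)|,n,h)=(i',h')$, then the entering index is the $i'$-th smallest index of $\Gamma^+(B)$ and the memory state becomes $h'$. *)

(* Defs.v *)
From HB Require Import structures.
From mathcomp Require Import all_boot all_order all_algebra.
From Stdlib Require Reals.

Set Implicit Arguments.
Unset Strict Implicit.
Unset Printing Implicit Defensive.

Import Order.TTheory GRing.Theory Num.Theory.

Definition little_o_n_over_log (ell : nat -> nat) : Prop :=
  forall eps : Rdefinitions.R, Rdefinitions.Rlt (Rdefinitions.IZR BinNums.Z0) eps ->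
  exists N : nat, forall n : nat, (N <= n)%N ->
    Rdefinitions.Rle
      (Rdefinitions.Rmult (Raxioms.INR (ell n)) (Rpower.ln (Raxioms.INR n)))
      (Rdefinitions.Rmult eps (Raxioms.INR n)).

Local Open Scope ring_scope.

(* A linear program  max c^T x  s.t.  A x = b, x >= 0,  with n variables,
   m equality constraints, together with the initial basis given to the simplex method. *)
Record LP (n : nat) := mkLP {
  lp_m : nat;
  lp_A : 'M[rat]_(lp_m, n);
  lp_b : 'cV[rat]_lp_m;
  lp_c : 'cV[rat]_n;
  lp_B0 : {set 'I_n}
}.

Section LPDefs.
Variables (n : nat) (L : LP n).
Let m := lp_m L.
Let A := lp_A L.
Let b := lp_b L.
Let c := lp_c L.

Definition basis_mx (B : {set 'I_n}) : 'M[rat]_m :=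
  \matrix_(i < m, k < m) nth 0 [seq A i j | j <- enum B] k.

Definition cost_B (B : {set 'I_n}) : 'rV[rat]_m :=
  \row_(k < m) nth 0 [seq c j 0 | j <- enum B] k.

Definition is_basis (B : {set 'I_n}) : bool :=
  (#|B| == m) && (basis_mx B \in unitmx).

Definition basic_sol (B : {set 'I_n}) : 'cV[rat]_n :=
  let xB := invmx (basis_mx B) *m b in
  \col_(j < n) (if j \in B then nth 0 [seq xB i 0 | i <- enum 'I_m] (index j (enum B))
                else 0).

Definition feasible_basis (B : {set 'I_n}) : bool :=
  is_basis B && [forall j, 0 <= basic_sol B j 0].

Definition red_cost (B : {set 'I_n}) (i : 'I_n) : rat :=
  c i 0 - (cost_B B *m invmx (basis_mx B) *m col i A) 0 0.

Definition improving (B : {set 'I_n}) : {set 'I_n} :=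
  [set i | (i \notin B) && (0 < red_cost B i)].

Definition optimal_basis (B : {set 'I_n}) : bool :=
  feasible_basis B && (improving B == set0).

Definition LP_well_formed : Prop :=
  \rank A = m /\
  (exists x : 'cV[rat]_n, A *m x = b /\ forall j, 0 <= x j 0) /\
  (exists M : rat, forall x : 'cV[rat]_n,
      A *m x = b -> (forall j, 0 <= x j 0) -> (c^T *m x) 0 0 <= M) /\
  feasible_basis (lp_B0 L).

(* i is the k-th smallest element (k >= 1) of S *)
Definition kth_smallest (S : {set 'I_n}) (k : nat) (i : 'I_n) : bool :=
  (i \in S) && (#|[set j in S | (nat_of_ord j < nat_of_ord i)%N]| == k.-1)%N.

(* one iteration of the simplex method with the ell-index-based pivot rule
   induced by P, on states (basis, memory state).  The leaving index j is
   any index making the new set a feasible basis. *)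
Definition simplex_step (P : nat -> nat -> nat -> nat * nat)
    (s s' : {set 'I_n} * nat) : Prop :=
  let B := s.1 in let h := s.2 in
  let G := improving B in
  feasible_basis B /\ G != set0 /\
  exists (i j : 'I_n),
    kth_smallest G (P #|G| n h).1 i /\ j \in B /\
    s'.1 = i |: (B :\ j) /\ feasible_basis s'.1 /\ s'.2 = (P #|G| n h).2.

Definition simplex_run_length (P : nat -> nat -> nat -> nat * nat) (T : nat) : Prop :=
  exists s : nat -> {set 'I_n} * nat,
    s 0%N = (lp_B0 L, 1%N) /\
    (forall t, (t < T)%N -> simplex_step P (s t) (s t.+1)) /\
    optimal_basis (s T).1.

End LPDefs.

(* P is an ell-index-selector function (the constraint is imposed for k >= 1,
   since {1,...,0} is empty; only k = |Gamma^+(B)| >= 1 is ever used). *)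
Definition index_selector (ell : nat -> nat) (P : nat -> nat -> nat -> nat * nat) : Prop :=
  forall k n h : nat, (0 < k)%N ->
    (1 <= (P k n h).1 <= k)%N /\ (1 <= (P k n h).2 <= ell n)%N.

(* Main.v *)
(** Keep the number of improving variables equal to a constant [K] along the run.
   The rule is then a finite automaton, and the sequence of chosen ranks is
   eventually periodic with preperiod and period of total length at most [ell n].

   The program is a tree of small polygons ("chains") with [K] nodes, one per rank.
   A chain is the epigraph of a convex piecewise linear function: the simplex
   method walks along its vertices to the right or to the left, according to the
   sign of an objective that a node inherits from its parent. A chain away from its
   ends has exactly one improving variable, whatever that sign is, and thus occupies
   exactly one rank. A counter node ("main") carries a companion variable that is
   improving exactly when the node itself is not, so it also contributes one.

   Since [ell n] is small compared to [K], some rank [r] that is chosen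
   periodically is followed (or, up to reversing the order of the variables,
   preceded) by many ranks that are never chosen, before the next periodically
   chosen one. The counter nodes live there: they share the rank [r] and form a
   binary counter in the manner of Klee and Minty, each choice of rank [r] flipping
   the lowest active bit. A root chain of the right length keeps the counter asleep
   during the preperiod. The chain at any other rank [q] is attached to the bit whose
   index is the 2-adic valuation of the number of choices of [r] per period: its
   direction is then reversed from one period to the next, so it never reaches an
   end. The counter has about [n / ell n] bits, which is more than any multiple of
   [log n]. *)

Require Import Defs.
From mathcomp Require Import all_boot all_order all_algebra.
From Stdlib Require ClassicalEpsilon.

Set Implicit Arguments.
Unset Strict Implicit.
Unset Printing Implicit Defensive.

(** * From natural logarithms to base 2 *)

Module LittleO.
From Stdlib Require Import Reals Lra.

Lemma ln_expn2 L : (INR L * ln 2 <= ln (INR (expn 2 L)))%R.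
Proof.
elim: L => [|L IH]; first by rewrite /= ln_1; lra.
have pos : (0 < INR (expn 2 L))%R by apply: lt_0_INR; apply/ltP; rewrite expn_gt0.
rewrite expnS -multE mult_INR ln_mult //; last by rewrite /=; lra.
by rewrite S_INR; have -> : INR 2 = 2%R by []; lra.
Qed.

Lemma little_o_nat ell : little_o_n_over_log ell ->
  forall k, exists N, forall n, leq N n -> leq (muln (muln k (ell n)) (trunc_log 2 n)) n.
Proof.
move=> small k; have k0 := pos_INR k.
(* With this value, [2 * k * eps < 1]. The factor 2 pays for replacing [ln n] by [trunc_log 2 n],
   since [ln 2 > 1 / 2]. *)
have eps0 : (0 < / (2 * (INR k + 1)))%R by apply: Rinv_0_lt_compat; lra.
have [N HN] := small _ eps0; exists (maxn N 1) => n; rewrite geq_max => /andP[Nn n0].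
have {}HN := HN n Nn; set L := trunc_log 2 n.
have nL : leq (expn 2 L) n by apply: trunc_logP.
have n0R : (0 < INR n)%R by apply: lt_0_INR; apply/ltP.
have lnL : (INR L * ln 2 <= ln (INR n))%R.
  apply: Rle_trans (ln_expn2 L) _.
  have pos : (0 < INR (expn 2 L))%R by apply: lt_0_INR; apply/ltP; rewrite expn_gt0.
  have /Rle_lt_or_eq_dec [lt|->] : (INR (expn 2 L) <= INR n)%R by apply: le_INR; apply/leP.
    by left; apply: ln_increasing.
  by right.
have L2 : (INR L <= 2 * ln (INR n))%R by have := ln_lt_2; have := pos_INR L; nra.
apply/leP; apply: INR_le; rewrite -!multE !mult_INR.
have ell0 := pos_INR (ell n).
have H1 : (INR (ell n) * INR L <= 2 * (INR (ell n) * ln (INR n)))%R by nra.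
have H2 : (INR k * (2 * (/ (2 * (INR k + 1)) * INR n)) <= INR n)%R.
  have -> : (INR k * (2 * (/ (2 * (INR k + 1)) * INR n)) = INR n - INR n / (INR k + 1))%R by field; lra.
  have : (0 < INR n / (INR k + 1))%R by apply: Rdiv_lt_0_compat; lra.
  by lra.
by rewrite Rmult_assoc; apply: Rle_trans H2; apply: Rmult_le_compat_l => //; lra.
Qed.
End LittleO.

From mathcomp Require Import zify ring lra.

Import Order.TTheory GRing.Theory Num.Theory.

Local Open Scope ring_scope.

(** * Bases of linear programs *)

Section LinearPrograms.
Variables (n : nat) (L : LP n).
Local Notation m := (lp_m L).
Local Notation A := (lp_A L).
Local Notation b := (lp_b L).
Local Notation c := (lp_c L).
Implicit Types (B : {set 'I_n}) (y : 'rV[rat]_m).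

Definition basic_index B (eqB : #|B| = m) (k : 'I_m) : 'I_n :=
  enum_val (cast_ord (esym eqB) k).

Lemma basic_indexP B (eqB : #|B| = m) k : basic_index eqB k \in B.
Proof. exact: enum_valP. Qed.

Lemma basic_index_onto B (eqB : #|B| = m) j :
  j \in B -> exists k : 'I_m, j = basic_index eqB k.
Proof.
move=> jB; exists (cast_ord eqB (enum_rank_in jB j)).
by rewrite /basic_index cast_ordK enum_rankK_in.
Qed.

Lemma nth_map_enum (T : Type) (x0 : T) (f : 'I_n -> T) B (eqB : #|B| = m) (k : 'I_m) :
  nth x0 [seq f j | j <- enum B] k = f (basic_index eqB k).
Proof.
have lt : (k < size (enum B))%N by rewrite -cardE eqB.
by rewrite /basic_index /enum_val (nth_map (enum_default (cast_ord (esym eqB) k))).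
Qed.

Lemma mul_basis_mx B (eqB : #|B| = m) y k :
  (y *m basis_mx L B) 0 k = (y *m A) 0 (basic_index eqB k).
Proof.
rewrite !mxE; apply: eq_bigr => i _.
by rewrite !mxE (nth_map_enum _ _ eqB).
Qed.

Lemma is_basis_of_kernel B : #|B| = m ->
  (forall y, (forall j, j \in B -> (y *m A) 0 j = 0) -> y = 0) -> is_basis L B.
Proof.
move=> eqB ker; rewrite /is_basis eqB eqxx /= -row_free_unit -kermx_eq0.
apply/eqP/row_matrixP => i; rewrite row0; apply: ker => j /(basic_index_onto eqB)[k ->].
by rewrite -mul_basis_mx -row_mul mulmx_ker row0 mxE.
Qed.

Lemma full_row_rank : (forall y, y *m A = 0 -> y = 0) -> \rank A = m.
Proof.
move=> ker; apply/eqP; rewrite -/(row_free A) -kermx_eq0.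
by apply/eqP/row_matrixP => i; rewrite row0; apply: ker; rewrite -row_mul mulmx_ker row0.
Qed.

Lemma dual_solution B : is_basis L B ->
  exists y, (forall j, j \in B -> (y *m A) 0 j = c j 0) /\
            (forall i, red_cost L B i = c i 0 - (y *m A) 0 i).
Proof.
case/andP=> /eqP eqB uB; exists (cost_B L B *m invmx (basis_mx L B)); split.
  move=> j /(basic_index_onto eqB)[k ->].
  by rewrite -mul_basis_mx mulmxKV // mxE (nth_map_enum _ _ eqB).
move=> i; rewrite /red_cost; congr (_ - _).
by rewrite [LHS]mxE [RHS]mxE; apply: eq_bigr => k _; rewrite [col i _ _ _]mxE.
Qed.

Lemma basic_sol_out B j : j \notin B -> basic_sol L B j 0 = 0.
Proof. by move=> jB; rewrite mxE (negbTE jB). Qed.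

Lemma basic_index_rank B (eqB : #|B| = m) k :
  index (basic_index eqB k) (enum B) = k.
Proof.
rewrite /basic_index /enum_val index_uniq ?enum_uniq //.
by rewrite -cardE; apply: ltn_ord.
Qed.

Lemma basic_sol_eq B : is_basis L B -> A *m basic_sol L B = b.
Proof.
case/andP=> /eqP eqB uB; set xB := invmx (basis_mx L B) *m b.
have <- : basis_mx L B *m xB = b by rewrite mulKVmx.
apply/matrixP => i z; rewrite (ord1 z) [LHS]mxE [RHS]mxE.
rewrite (bigID (mem B)) /= [X in _ + X]big1 ?addr0; last first.
  by move=> j jB; rewrite basic_sol_out // mulr0.
rewrite big_enum_val (reindex (cast_ord (esym eqB))) /=; last first.
  by apply: onW_bij; exists (cast_ord eqB); [apply: cast_ordKV | apply: cast_ordK].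
apply: eq_bigr => k _; rewrite -/(basic_index eqB k).
rewrite [basis_mx _ _ _ _]mxE (nth_map_enum _ _ eqB) [basic_sol _ _ _ _]mxE basic_indexP.
by rewrite basic_index_rank (nth_map k) ?size_enum_ord // nth_ord_enum.
Qed.

Lemma weak_duality y : (forall j, c j 0 <= (y *m A) 0 j) ->
  forall x : 'cV[rat]_n, A *m x = b -> (forall j, 0 <= x j 0) ->
  (c^T *m x) 0 0 <= (y *m b) 0 0.
Proof.
move=> dual x <- x_ge0; rewrite mulmxA !mxE; apply: ler_sum => j _.
by rewrite [c^T _ _]mxE ler_wpM2r.
Qed.

End LinearPrograms.

(** * Programs with labelled variables and rows *)

Section Labelled.
Variables (n : nat) (V W : finType) (e : V -> 'I_n).
Hypothesis e_inj : injective e.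
Variables (a : W -> V -> rat) (rhs : W -> rat) (cost : V -> rat) (B0 : {set V}).

Definition label (j : 'I_n) : option V := [pick v | e v == j].

Lemma labelK v : label (e v) = Some v.
Proof.
rewrite /label; case: pickP => [u /eqP/e_inj-> // | /(_ v)]; by rewrite eqxx.
Qed.

(* The indices outside the range of [e] pad the program to [n] variables: their
   columns are zero and their cost is negative, so that they never improve. *)
Definition labelled_lp : LP n :=
  @mkLP n #|W|
    (\matrix_(i, j) oapp (a (enum_val i)) 0 (label j))
    (\col_i rhs (enum_val i))
    (\col_j oapp cost (-1) (label j))
    (e @: B0).
Local Notation L := labelled_lp.

Definition price (y : W -> rat) (v : V) : rat := \sum_w y w * a w v.

Definition dual_fun (y : 'rV[rat]_#|W|) (w : W) : rat := y 0 (enum_rank w).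

Lemma price_dual_fun (y : 'rV[rat]_#|W|) v :
  (y *m lp_A L) 0 (e v) = price (dual_fun y) v.
Proof.
rewrite mxE /price (reindex enum_rank) /=; last exact/onW_bij/enum_rank_bij.
by apply: eq_bigr => w _; rewrite mxE labelK /= enum_rankK.
Qed.

Lemma price_padding (y : 'rV[rat]_#|W|) j : label j = None -> (y *m lp_A L) 0 j = 0.
Proof. by move=> jN; rewrite mxE big1 // => i _; rewrite mxE jN mulr0. Qed.

Lemma label_Some j v : label j = Some v -> j = e v.
Proof. by rewrite /label; case: pickP => // u /eqP <- [->]. Qed.

Lemma labelled_basis (B : {set V}) : #|B| = #|W| ->
  (forall y : W -> rat, (forall v, v \in B -> price y v = 0) -> forall w, y w = 0) ->
  is_basis L (e @: B).
Proof.
move=> eqB ker; apply: is_basis_of_kernel; first by rewrite card_imset.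
move=> y y0; apply/rowP => i; rewrite mxE -(enum_valK i).
apply: (ker (dual_fun y)) => v vB; rewrite -price_dual_fun; apply: y0.
exact: imset_f.
Qed.

(** On a basis these equations determine [y], so reduced costs can later be found by solving for [y]
    by hand, without inverting the basis matrix. *)
Lemma labelled_improving (B : {set V}) : is_basis L (e @: B) ->
  exists y : W -> rat, (forall v, v \in B -> price y v = cost v) /\
  improving L (e @: B) = e @: [set v | (v \notin B) && (0 < cost v - price y v)].
Proof.
move=> basB; have [y [yB rcE]] := dual_solution basB.
exists (dual_fun y); split=> [v vB|].
  by rewrite -price_dual_fun yB ?imset_f // mxE labelK.
apply/setP => j; rewrite inE rcE; case lj: (label j) => [v|].
  rewrite (label_Some lj) !(mem_imset _ _ e_inj) price_dual_fun inE.
  by rewrite [lp_c _ _ _]mxE labelK.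
rewrite price_padding // [lp_c _ _ _]mxE lj /= subr0 oppr_gt0 ltr10 andbF.
by apply/esym/negbTE/imsetP => -[v _ jv]; move: lj; rewrite jv labelK.
Qed.

Lemma labelled_solution (B : {set V}) : is_basis L (e @: B) ->
  exists x : V -> rat, [/\ forall w, \sum_v a w v * x v = rhs w,
    forall v, v \notin B -> x v = 0 &
    feasible_basis L (e @: B) <-> forall v, 0 <= x v].
Proof.
move=> basB; have Ax := basic_sol_eq basB.
have out j : label j = None -> basic_sol L (e @: B) j 0 = 0.
  move=> jN; apply: basic_sol_out; apply/imsetP => -[v _ jv].
  by move: jN; rewrite jv labelK.
exists (fun v => basic_sol L (e @: B) (e v) 0); split.
- move=> w; move/matrixP/(_ (enum_rank w) 0): Ax; rewrite [RHS]mxE enum_rankK => <-.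
  rewrite [RHS]mxE (bigID (mem (e @: setT))) /= [X in _ + X]big1 ?addr0.
    rewrite big_imset /=; last by move=> u v _ _ /e_inj.
    apply: eq_big => [v|v _]; first by rewrite inE.
    by rewrite /= [X in _ = X * _]mxE labelK /= enum_rankK.
  move=> j /imsetP jN; rewrite out ?mulr0 //; case lj: (label j) => [v|//].
  by case: jN; exists v; rewrite ?inE // (label_Some lj).
- by move=> v vB; apply: basic_sol_out; rewrite (mem_imset _ _ e_inj).
split=> [/andP[_ /forallP x_ge0] v|x_ge0]; first exact: x_ge0.
rewrite /feasible_basis basB; apply/forallP => j; case lj: (label j) => [v|].
  by rewrite (label_Some lj).
by rewrite out.
Qed.

(** A dual feasible [y] bounds the objective by weak duality; a padding column is zero with cost
    [-1], so its dual constraint holds for free. *)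
Lemma labelled_well_formed : is_basis L (e @: B0) -> feasible_basis L (e @: B0) ->
  (exists y : W -> rat, forall v, cost v <= price y v) -> LP_well_formed L.
Proof.
move=> basB feasB [y dual]; split; [|split; [|split=> //]].
- apply: full_row_rank => z zA; case/andP: basB => /eqP eqB uB.
  apply: (can_inj (mulmxK uB)); rewrite mul0mx; apply/rowP => k.
  by rewrite (mul_basis_mx eqB) zA !mxE.
- exists (basic_sol L (e @: B0)); split; first exact: basic_sol_eq.
  by case/andP: feasB => _ /forallP.
have dualL j : lp_c L j 0 <= ((\row_i y (enum_val i)) *m lp_A L) 0 j.
  case lj: (label j) => [v|]; last by rewrite price_padding // mxE lj /= lerN10.
  rewrite (label_Some lj) price_dual_fun mxE labelK /= (le_trans (dual v)) //.
  by apply: ler_sum => w _; rewrite /dual_fun mxE enum_rankK.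
by eexists; apply: weak_duality dualL.
Qed.

End Labelled.

(** * Chains *)

(** Centred at [j.+1], so that no predecessor occurs. Row [j.+1] of a chain applies it to the primal
    values, and the price of [w_{j+1}] applies it to the row values. *)
Definition second_diff (w : nat -> rat) (j : nat) : rat := w j - 2 * w j.+1 + w j.+2.

Definition flip (M : nat) (w : nat -> rat) (j : nat) : rat := w (M.+1 - j)%N.

Lemma second_diff_flip M w j : (j < M)%N ->
  second_diff (flip M w) j = second_diff w (M - j.+1).
Proof.
move=> jM; rewrite /second_diff /flip.
have -> : (M.+1 - j = (M - j.+1).+2)%N by lia.
have -> : (M.+1 - j.+1 = (M - j.+1).+1)%N by lia.
have -> : (M.+1 - j.+2 = M - j.+1)%N by lia.
by ring.
Qed.

Lemma linear_from_left (k : nat) (y : nat -> rat) (C0 : rat) : y 0%N = 0 ->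
  ((0 < k)%N -> y 1%N = C0) -> (forall j, (j.+1 < k)%N -> second_diff y j = 0) ->
  forall j, (j <= k)%N -> y j = C0 * j%:R.
Proof.
move=> y0 y1 y2.
suff H j : (j < k)%N -> y j = C0 * j%:R /\ y j.+1 = C0 * j.+1%:R.
  by case=> [|j] jk; [rewrite y0 mulr0 | case: (H j)].
elim: j => [|j IH] jk; first by rewrite y0 mulr0 mulr1 y1.
have [] := IH _; first by lia.
move=> E0 E1; split=> //; have := y2 j jk; rewrite /second_diff E0 E1.
rewrite -[j.+2%:R]natr1 -[j.+1%:R]natr1; lra.
Qed.

(** At the vertex [k] every column except those of [w_k] and [w_{k+1}] is tight. The row values are
    therefore linear on each side of this gap and vanish just outside the chain; the end columns
    give the two slopes. *)
Lemma chain_dual (M k : nat) (y : nat -> rat) (C0 C1 : rat) : (k <= M)%N ->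
  y 0%N = 0 -> y M.+1 = 0 ->
  ((0 < k)%N -> y 1%N = C0) -> ((k < M)%N -> y M = C1) ->
  (forall j, (j < M)%N -> j.+1 != k -> j != k -> second_diff y j = 0) ->
  (forall j, (j <= k)%N -> y j = C0 * j%:R) /\
  (forall j, (k < j)%N -> (j <= M.+1)%N -> y j = C1 * (M.+1 - j)%:R).
Proof.
move=> kM y0 yM y1 yM1 y2; split.
  apply: linear_from_left => // j jk; apply: y2; lia.
move=> j kj jM; have := @linear_from_left (M - k) (flip M y) C1.
rewrite /flip subn0 subn1 /= => /(_ yM) H.
rewrite -(H _ _ (M.+1 - j)%N) ?subKn //; first by move=> ?; apply: yM1; lia.
- by move=> i ik; rewrite -/(flip M y) second_diff_flip; [apply: y2; lia | lia].
- lia.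
Qed.

(** * Strictly convex sequences *)

Section Convex.
Variables (M : nat) (w : nat -> rat).

(** After the successor of a zero, a nonnegative strictly convex sequence increases strictly, which
    excludes a second zero further away. *)
Lemma convex_zeros_adjacent i i' :
  (forall j, (j <= M.+1)%N -> 0 <= w j) ->
  (forall j, (j < M)%N -> 1 / 2 <= second_diff w j) ->
  (i < i')%N -> (i' <= M.+1)%N -> w i = 0 -> w i' = 0 -> i' = i.+1.
Proof.
move=> w_ge0 cvx ii' iM wi wi'; apply/eqP; rewrite eqn_leq ii' andbT leqNgt.
apply/negP => lt.
have incr h : (i + h < M)%N -> w (i + h).+1 < w (i + h).+2.
  elim: h => [|h IH] hM; have := cvx _ hM; rewrite /second_diff.
    by rewrite addn0 wi; have := w_ge0 i.+1 ltac:(lia); lra.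
  by rewrite addnS; have := IH ltac:(lia); lra.
have [h Eh] : exists h, i' = (i + h).+2 by exists (i' - i.+2)%N; lia.
have := incr h ltac:(lia); have := w_ge0 (i + h).+1 ltac:(lia).
by rewrite -Eh wi'; lra.
Qed.

(** Each term is at most twice the previous one plus [3 / 2]. This crude bound is what the choice of
    [kap] relies on. *)
Lemma convex_bound_right i :
  (forall j, (j <= M.+1)%N -> 0 <= w j) ->
  (forall j, (j < M)%N -> second_diff w j <= 3 / 2) ->
  (0 < i)%N -> w i = 0 ->
  forall h, (i + h <= M.+1)%N -> w (i + h) <= 2 ^+ h.+1 - 2.
Proof.
move=> w_ge0 cvx i0 wi; elim=> [|h IH] hM; first by rewrite addn0 wi expr1; lra.
have := cvx (i + h).-1 ltac:(lia); rewrite /second_diff.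
have -> : ((i + h).-1.+1 = i + h)%N by lia.
rewrite -addnS.
have := w_ge0 (i + h).-1 ltac:(lia); have := IH ltac:(lia).
by rewrite ![2 ^+ h.+2]exprS; lra.
Qed.

Lemma convex_nonneg_right k :
  (forall j, (j < M)%N -> 1 / 2 <= second_diff w j) ->
  w k = 0 -> w k.+1 = 0 ->
  forall h, (k + h <= M)%N -> 0 <= w (k + h) <= w (k + h).+1.
Proof.
move=> cvx wk wk1; elim=> [|h IH] hM; first by rewrite addn0 wk wk1 lexx.
have /andP[] := IH ltac:(lia); have := cvx (k + h)%N ltac:(lia).
rewrite /second_diff addnS => *; apply/andP; split; lra.
Qed.
End Convex.

Lemma convex_bound (M i : nat) (w : nat -> rat) :
  (forall j, (j <= M.+1)%N -> 0 <= w j) ->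
  (forall j, (j < M)%N -> second_diff w j <= 3 / 2) ->
  (0 < i <= M)%N -> w i = 0 ->
  forall j, (j <= M.+1)%N -> w j <= 2 ^+ M.+2.
Proof.
move=> w_ge0 cvx /andP[i0 iM] wi j jM.
have fin h : (h < M.+2)%N -> 2 ^+ h.+1 - 2 <= 2 ^+ M.+2 :> rat.
  move=> hM; rewrite lerBlDr (le_trans (_ : _ <= 2 ^+ M.+2)) ?lerDl //.
  by rewrite ler_eXn2l //; lra.
have [ij|ji] := leqP i j.
  rewrite -(subnKC ij); apply: le_trans (fin (j - i)%N _); last lia.
  by apply: (convex_bound_right w_ge0 cvx) => //; lia.
have -> : w j = flip M w ((M.+1 - i) + (i - j)) by rewrite /flip; congr w; lia.
apply: le_trans (fin (i - j)%N _); last lia.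
apply: (@convex_bound_right M) => //; try lia.
- by move=> l lM; apply: w_ge0; lia.
- by move=> l lM; rewrite second_diff_flip //; apply: cvx; lia.
- by rewrite /flip subKn //; lia.
Qed.

(** The sequence grows away from the two adjacent zeros, to the right by convexity and to the left
    by reflection. *)
Lemma convex_nonneg (M k : nat) (w : nat -> rat) : (k <= M)%N ->
  (forall j, (j < M)%N -> 1 / 2 <= second_diff w j) ->
  w k = 0 -> w k.+1 = 0 -> forall j, (j <= M.+1)%N -> 0 <= w j.
Proof.
move=> kM cvx wk wk1 j jM; have [kj|jk] := ltnP k j.
  have hM : (k + (j - k.+1) <= M)%N by lia.
  have /andP[] := convex_nonneg_right cvx wk wk1 hM.
  have -> : ((k + (j - k.+1)).+1 = j)%N by lia.
  exact: le_trans.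
have -> : w j = flip M w ((M - k) + (k.+1 - j)).
  by rewrite /flip; congr w; lia.
have -> : (M - k + (k.+1 - j) = (M - k + (k - j)).+1)%N by lia.
have : 0 <= flip M w (M - k + (k - j)) <= flip M w (M - k + (k - j)).+1.
  apply: (@convex_nonneg_right M) => //; last by lia.
  - by move=> l lM; rewrite second_diff_flip //; apply: cvx; lia.
  - by rewrite /flip; have -> : (M.+1 - (M - k) = k.+1)%N by lia.
  - by rewrite /flip; have -> : (M.+1 - (M - k).+1 = k)%N by lia.
by case/andP; apply: le_trans.
Qed.

Lemma sum_delta (N i : nat) (f : nat -> rat) :
  \sum_(j < N) f j * (j == i :> nat)%:R = if (i < N)%N then f i else 0.
Proof.
case: ltnP => [iN|Ni].
  rewrite (bigD1 (Ordinal iN)) //= eqxx mulr1 big1 ?addr0 // => j ji.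
  by move: ji; rewrite -val_eqE /= => /negbTE->; rewrite mulr0.
rewrite big1 // => j _; case: eqP => [ji|_]; last by rewrite mulr0.
by have := ltn_ord j; rewrite ji ltnNge Ni.
Qed.

Lemma sum_delta_fin (C : finType) (c : C) (f : C -> rat) :
  \sum_c' (c' == c)%:R * f c' = f c.
Proof.
rewrite (bigD1 c) //= eqxx mul1r big1 ?addr0 // => c' cc'.
by rewrite (negbTE cc') mul0r.
Qed.

(** * The constraint matrix of a tree of chains *)

Section ChainSystem.
Variables (C : finType) (M : C -> nat) (par : C -> option C) (main : C -> bool).
Variable kap : rat.

(* Component [c] has the variables [w_0, ..., w_{M+1}] (indices [0] to [M c + 1]),
   a companion [v] (index [M c + 2]) and the slack of [v] (index [M c + 3]).
   Row [0] is [v + slack = 1]; row [j] with [0 < j <= M c] says that the second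
   difference of [w] at [j] is [1], up to small multiples of the end variables of
   the children and of [v] in row [M c]. The vertices are [w_k = w_{k+1} = 0]. *)
Definition cvar := {c : C & 'I_(M c).+4}.
Definition crow := {c : C & 'I_(M c).+1}.

Definition mkvar (c : C) (k : nat) : cvar := @Tagged C c (fun c => 'I_(M c).+4) (inord k).
Definition mkrow (c : C) (j : nat) : crow := @Tagged C c (fun c => 'I_(M c).+1) (inord j).

Definition chain_coef (c : C) (j : nat) (c' : C) (k : nat) : rat :=
  if j == 0%N then (c' == c)%:R * ((k == (M c').+2)%:R + (k == (M c').+3)%:R)
  else (c' == c)%:R * ((k == j.-1)%:R - 2 * (k == j)%:R + (k == j.+1)%:R)
    + (j == M c)%:R * kap * ((par c' == Some c)%:R * ((k == 0%N)%:R - (k == (M c').+1)%:R)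
                           - (c' == c)%:R * ((main c)%:R * (k == (M c).+2)%:R)).

Definition chain_mx (w : crow) (v : cvar) : rat :=
  chain_coef (tag w) (tagged w) (tag v) (tagged v).

Lemma mkvar_tagged (v : cvar) : mkvar (tag v) (tagged v) = v.
Proof. by case: v => c k; rewrite /mkvar /= inord_val. Qed.

Lemma mkrow_tagged (w : crow) : mkrow (tag w) (tagged w) = w.
Proof. by case: w => c k; rewrite /mkrow /= inord_val. Qed.

Lemma sum_var (F : cvar -> rat) : \sum_v F v = \sum_c \sum_(k < (M c).+4) F (mkvar c k).
Proof.
rewrite [RHS]sig_big_dep /=; apply: eq_big => [v|v _]; first by [].
by rewrite mkvar_tagged.
Qed.

Lemma sum_row (F : crow -> rat) : \sum_w F w = \sum_c \sum_(k < (M c).+1) F (mkrow c k).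
Proof.
rewrite [RHS]sig_big_dep /=; apply: eq_big => [v|v _]; first by [].
by rewrite mkrow_tagged.
Qed.

(** Extended by zero, so that one second difference describes all columns of a chain, the end
    variables included. *)
Definition row_val (y : crow -> rat) (c : C) (j : nat) : rat :=
  if (0 < j <= M c)%N then y (mkrow c j) else 0.

Definition par_val (y : crow -> rat) (c : C) : rat :=
  if par c is Some p then kap * row_val y p (M p) else 0.

(** A column meets the rows of its own component (the part [f]) and, for an end variable, the last
    row of the parent (the part [g]). *)
Lemma price_chain (y : crow -> rat) (c : C) (k : nat) :
  (k < (M c).+4)%N ->
  price chain_mx y (mkvar c k) =
    ((k == (M c).+2)%:R + (k == (M c).+3)%:R) * y (mkrow c 0)
    + (row_val y c k.-1 - 2 * row_val y c k + row_val y c k.+1)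
    + ((k == 0%N)%:R - (k == (M c).+1)%:R) * par_val y c
    - (main c)%:R * (k == (M c).+2)%:R * kap * row_val y c (M c).
Proof.
move=> kM; rewrite /price sum_row.
pose z c' j := y (mkrow c' j).
pose f c' := ((k == (M c).+2)%:R + (k == (M c).+3)%:R) * z c' 0
  + (row_val y c' k.-1 - 2 * row_val y c' k + row_val y c' k.+1)
  - (main c')%:R * (k == (M c').+2)%:R * kap * row_val y c' (M c').
pose g c' := (par c == Some c')%:R * (((k == 0%N)%:R - (k == (M c).+1)%:R) * kap * row_val y c' (M c')).
have -> : \sum_c' \sum_(j < (M c').+1) y (mkrow c' j) * chain_mx (mkrow c' j) (mkvar c k)
   = \sum_c' ((c' == c)%:R * f c' + g c').
  apply: eq_bigr => c' _; rewrite big_ord_recl /=.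
  rewrite /chain_mx /= !inordK // /chain_coef eqxx -/(z c' 0).
  have eqc : (c == c')%:R = (c' == c)%:R :> rat by rewrite eq_sym.
  have sh (N i : nat) : \sum_(j < N) z c' j.+1 * (j.+1 == i :> nat)%:R
       = if (0 < i <= N)%N then z c' i else 0.
    case: i => [|i]; first by rewrite big1 // => j _; rewrite mulr0.
    by have := sum_delta N i (fun j => z c' j.+1); rewrite /=; under eq_bigr do rewrite -eqSS.
  transitivity (z c' 0 * ((c' == c)%:R * ((k == (M c).+2)%:R + (k == (M c).+3)%:R)) +
     ((c' == c)%:R * (\sum_(j < M c') z c' j.+1 * (j.+1 == k.+1 :> nat)%:R
       - 2 * (\sum_(j < M c') z c' j.+1 * (j.+1 == k :> nat)%:R)
       + \sum_(j < M c') z c' j.+1 * (j.+1 == k.-1 :> nat)%:R)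
     + (kap * ((par c == Some c')%:R * ((k == 0%N)%:R - (k == (M c).+1)%:R)
          - (c' == c)%:R * ((main c')%:R * (k == (M c').+2)%:R))) *
        \sum_(j < M c') z c' j.+1 * (j.+1 == M c' :> nat)%:R)).
    rewrite eqc; congr (_ + _).
    rewrite !mulr_sumr -sumrB -big_split !mulr_sumr -big_split /=; apply: eq_bigr => j _.
    have jM : (bump 0 j < (M c').+1)%N by rewrite /bump /= add1n ltnS.
    rewrite !inordK // /bump /= add1n -/(z c' j.+1).
    have -> : (k == j.+1.-1) = (j.+1 == k.+1) by rewrite eqSS eq_sym.
    have -> : (k == j.+1) = (j.+1 == k) by rewrite eq_sym.
    have -> : (k == j.+2) = (j.+1 == k.-1) by lia.
    by ring.
  rewrite !sh /f /g; rewrite -!/(row_val y c' _).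
  by ring.
rewrite big_split /= sum_delta_fin /f /g.
set S := \sum_i _; have -> : S = ((k == 0%N)%:R - (k == (M c).+1)%:R) * par_val y c.
  rewrite /S /par_val; case: (par c) => [p|]; last by rewrite mulr0 big1 // => i _; rewrite mul0r.
  rewrite -[RHS](sum_delta_fin p (fun c' => ((k == 0%N)%:R - (k == (M c).+1)%:R) * (kap * row_val y c' (M c')))).
  apply: eq_bigr => c' _.
  have -> : (Some p == Some c') = (c' == p) by apply/eqP/eqP => [[->]|->].
  by ring.
by rewrite -/(z c 0); ring.
Qed.

Definition col_val (x : cvar -> rat) (c : C) (k : nat) : rat := x (mkvar c k).

(** The perturbation of the last row of [c]. As long as it is at most [1 / 2] in absolute value, the
    chain stays strictly convex. *)
Definition load (x : cvar -> rat) (c : C) : rat :=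
  kap * (\sum_(c' | par c' == Some c) (col_val x c' 0 - col_val x c' (M c').+1)
         - (main c)%:R * col_val x c (M c).+2).

Lemma bound_row_chain (x : cvar -> rat) (c : C) :
  \sum_v chain_mx (mkrow c 0) v * x v = col_val x c (M c).+2 + col_val x c (M c).+3.
Proof.
rewrite sum_var.
pose f c' := col_val x c' (M c').+2 + col_val x c' (M c').+3.
rewrite -[RHS]/(f c) -[RHS]sum_delta_fin; apply: eq_bigr => c' _.
rewrite /f.
have -> : col_val x c' (M c').+2 = \sum_(k < (M c').+4) col_val x c' k * (k == (M c').+2 :> nat)%:R.
  by rewrite sum_delta !ltnS leqnSn.
have -> : col_val x c' (M c').+3 = \sum_(k < (M c').+4) col_val x c' k * (k == (M c').+3 :> nat)%:R.
  by rewrite sum_delta ltnSn.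
rewrite -big_split mulr_sumr /=; apply: eq_bigr => k _.
by rewrite /chain_mx /= !inordK // /chain_coef /= /col_val; ring.
Qed.

Lemma chain_row_chain (x : cvar -> rat) (c : C) (j : nat) : (j < M c)%N ->
  \sum_v chain_mx (mkrow c j.+1) v * x v =
    second_diff (col_val x c) j + (j.+1 == M c)%:R * load x c.
Proof.
move=> jM; rewrite sum_var.
pose z := col_val x.
pose f c' := (z c' j - 2 * z c' j.+1 + z c' j.+2)
   - (j.+1 == M c)%:R * kap * (main c)%:R * z c' (M c).+2.
pose g c' := (j.+1 == M c)%:R * kap * ((par c' == Some c)%:R * (z c' 0 - z c' (M c').+1)).
transitivity (\sum_c' ((c' == c)%:R * f c' + g c')); last first.
  rewrite big_split /= sum_delta_fin /load /f /g /second_diff -/z -mulr_sumr.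
  rewrite [in RHS]big_mkcond /=.
  set S := \sum_i _; set S' := \sum_i _.
  have -> : S' = S; last by ring.
  by apply: eq_bigr => c' _; case: eqP => _; rewrite ?mul0r ?mul1r.
apply: eq_bigr => c' _.
rewrite /chain_mx /= inordK //.
have d i : (i < (M c').+4)%N -> z c' i = \sum_(k < (M c').+4) z c' k * (k == i :> nat)%:R.
  by move=> iM; rewrite sum_delta iM.
transitivity (\sum_(k < (M c').+4) z c' k * chain_coef c j.+1 c' k).
  by apply: eq_bigr => k _; rewrite inordK // mulrC.
have -> : (c' == c)%:R * f c' + g c' =
   (c' == c)%:R * ((\sum_(k < (M c').+4) z c' k * (k == j :> nat)%:R)
       - 2 * (\sum_(k < (M c').+4) z c' k * (k == j.+1 :> nat)%:R)
       + (\sum_(k < (M c').+4) z c' k * (k == j.+2 :> nat)%:R)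
   - (j.+1 == M c)%:R * kap * (main c)%:R * (\sum_(k < (M c').+4) z c' k * (k == (M c).+2 :> nat)%:R))
   + (j.+1 == M c)%:R * kap * ((par c' == Some c)%:R *
       (\sum_(k < (M c').+4) z c' k * (k == 0 :> nat)%:R - (\sum_(k < (M c').+4) z c' k * (k == (M c').+1 :> nat)%:R))).
  rewrite /g (d 0%N) // (d (M c').+1) ?ltnS; last by lia.
  congr (_ + _); case: (eqVneq c' c) => [Ec|_]; last by rewrite !mul0r.
  by rewrite /f !sum_delta Ec !ltnS !ifT //; lia.
rewrite !mulr_sumr -!sumrB -big_split /= -sumrB !mulr_sumr -big_split /=.
apply: eq_bigr => k _; rewrite /chain_coef /=; ring.
Qed.

End ChainSystem.
Arguments row_val : simpl never.

Definition sg (b : bool) : rat := if b then 1 else -1.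

(** * Bases and reduced costs of a tree of chains *)

Section ChainDynamics.
Variables (C : finType) (M : C -> nat) (par : C -> option C) (main : C -> bool).
Variables (dep : C -> nat) (kap : rat) (Mx : nat).
Hypothesis M_gt0 : forall c, (0 < M c)%N.
Hypothesis M_le : forall c, (M c <= Mx)%N.
Hypothesis par_main : forall c p, par c = Some p -> main p.
Hypothesis dep_par : forall c p, par c = Some p -> dep c = (dep p).+1.
Hypothesis dep_root : forall c, par c = None -> dep c = 0%N.
Hypothesis main_bit : forall c, main c -> par c <> None -> M c = 1%N.
Hypothesis kap_gt0 : 0 < kap.
Hypothesis kap_small : kap * (#|C|%:R * 2 ^+ Mx.+2 + 1) <= 1 / 2.

Local Notation cvar := (cvar M).
Local Notation crow := (crow M).
Local Notation mkvar := (@mkvar C M).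
Local Notation mkrow := (@mkrow C M).
Local Notation a := (@chain_mx C M par main kap).
Local Notation row_val := (@row_val C M).
Local Notation par_val := (@par_val C M par kap).
Local Notation load := (@load C M par main kap).

(* At every vertex the end variables [w_0] and [w_{M+1}] of [c] have the effective
   costs [- lam c + s * eta c] and [- lam c - s * eta c], where [s = 1] or [-1] is the
   inherited sign. The constant [offs c] centres the price of row [M c], so that what
   the children inherit has a magnitude independent of the vertex. *)
Definition eta c : rat :=
  if par c is None then 2 * (M c)%:R / ((M c)%:R + 1) else kap ^+ dep c.
Definition lam c : rat := eta c * ((M c)%:R + 1) / (M c)%:R.
Definition offs c : rat := eta c * (3 * (M c)%:R + 1) / (2 * (M c)%:R).
Definition drift c : rat := if par c is Some p then - (kap * offs p) else eta c.

Definition chain_cost (v : cvar) : rat :=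
  let c := tag v in let k := nat_of_ord (tagged v) in
  if k == 0%N then - lam c + drift c else
  if k == (M c).+1 then - lam c - drift c else
  if k == (M c).+2 then (if main c then kap * offs c else -1) else 0.

Definition config (pos : C -> nat) : {set cvar} :=
  [set v : cvar | (nat_of_ord (tagged v) != pos (tag v)) &&
     ((nat_of_ord (tagged v) != (pos (tag v)).+1) && (nat_of_ord (tagged v) != (M (tag v)).+2))].

Lemma mem_config pos c k : (k < (M c).+4)%N ->
  (mkvar c k \in config pos) = [&& k != pos c, k != (pos c).+1 & k != (M c).+2].
Proof. by move=> kM; rewrite inE /= inordK. Qed.

Lemma card_config pos : (forall c, (pos c <= M c)%N) -> #|config pos| = #|{: crow}|.
Proof.
move=> posM; apply/eqP; rewrite -(eqr_nat rat) -!sum1_card !natr_sum big_mkcond /=.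
rewrite sum_var sum_row; apply/eqP; apply: eq_bigr => c _.
transitivity (\sum_(k < (M c).+4) (1 - 1 * (k == pos c :> nat)%:R - 1 * (k == (pos c).+1 :> nat)%:R
   - 1 * (k == (M c).+2 :> nat)%:R) : rat).
  apply: eq_bigr => k _; rewrite mem_config //; have := posM c; move: (ltn_ord k).
  case: (eqVneq (nat_of_ord k) (pos c)); case: (eqVneq (nat_of_ord k) (pos c).+1);
    case: (eqVneq (nat_of_ord k) (M c).+2) => /= *; try lia; by ring.
rewrite !sumrB !(@sum_delta _ _ (fun=> 1)) !sumr_const !card_ord !ifT //; try by have := posM c; lia.
by rewrite -!natr1; ring.
Qed.

Section Dual.
Variables (pos : C -> nat).
Hypothesis posM : forall c, (pos c <= M c)%N.

(** The slack forces row [0] to have value zero. The slopes are the costs of the end variables,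
    corrected by what the last row of the parent contributes to their columns. *)
Lemma dual_chain (y : crow -> rat) (g : cvar -> rat) :
  (forall v, v \in config pos -> price a y v = g v) ->
  (forall c k, (0 < k <= M c)%N -> g (mkvar c k) = 0) ->
  (forall c, g (mkvar c (M c).+3) = 0) ->
  forall c, let C0 := g (mkvar c 0) - par_val y c in
  let C1 := g (mkvar c (M c).+1) + par_val y c in
  [/\ y (mkrow c 0) = 0,
      forall j, (j <= pos c)%N -> row_val y c j = C0 * j%:R &
      forall j, (pos c < j)%N -> (j <= (M c).+1)%N -> row_val y c j = C1 * ((M c).+1 - j)%:R].
Proof.
move=> yB g0 gs c C0 C1; have pM := posM c; have M0 := M_gt0 c.
have rv0 : row_val y c 0 = 0 by [].
have rvM j : (M c < j)%N -> row_val y c j = 0.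
  by move=> jM; rewrite /row_val ifF //; lia.
have y0 : y (mkrow c 0) = 0.
  have := yB (mkvar c (M c).+3); rewrite mem_config // price_chain //= gs.
  rewrite (rvM (M c).+2 ltac:(lia)) (rvM (M c).+3 ltac:(lia)) (rvM (M c).+4 ltac:(lia)) eqxx.
  have -> : ((M c).+3 == (M c).+2) = false by lia.
  have -> : ((M c).+3 == (M c).+1) = false by lia.
  by move=> /= H; rewrite -[RHS]H; [ring | lia].
have [] := @chain_dual (M c) (pos c) (row_val y c) C0 C1 pM rv0 (rvM _ (leqnn _)) _ _ _; last by [].
- move=> p0; have := yB (mkvar c 0); rewrite mem_config // price_chain // rv0 eqxx.
  have -> : (0%N == (M c).+2) = false by lia.
  have -> : (0%N == (M c).+3) = false by lia.
  have -> : (0%N == (M c).+1) = false by lia.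
  by move=> /= H; rewrite /C0 -H; [ring | lia].
- move=> pM'; have lt1 : ((M c).+1 < (M c).+4)%N by lia.
  have := yB (mkvar c (M c).+1); rewrite mem_config ?lt1 // price_chain ?lt1 //=.
  rewrite (rvM (M c).+1 ltac:(lia)) (rvM (M c).+2 ltac:(lia)).
  have -> : ((M c).+1 == (M c).+2) = false by lia.
  have -> : ((M c).+1 == (M c).+3) = false by lia.
  by rewrite eqxx => /= H; rewrite /C1 -H; [ring | lia].
- move=> j jM j1 j2; have := yB (mkvar c j.+1); rewrite mem_config; last by lia.
  rewrite price_chain //=; last by lia.
  rewrite g0; last by lia.
  have -> : (j.+1 == (M c).+2) = false by lia.
  have -> : (j.+1 == (M c).+3) = false by lia.
  have -> : (j.+1 == (M c).+1) = false by lia.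
  by rewrite /second_diff => /= H; rewrite -[RHS]H; [ring | lia].
Qed.

Lemma row_valE (y : crow -> rat) w :
  y w = if nat_of_ord (tagged w) == 0%N then y (mkrow (tag w) 0) else row_val y (tag w) (tagged w).
Proof.
rewrite -{1}(mkrow_tagged w); case: eqP => [->//|/eqP nz].
by rewrite /row_val lt0n nz -ltnS ltn_ord.
Qed.

(** Induction on the depth: once the row values of the parent vanish, both slopes of the chain
    vanish. *)
Lemma config_kernel (y : crow -> rat) :
  (forall v, v \in config pos -> price a y v = 0) -> forall w, y w = 0.
Proof.
move=> /(@dual_chain y (fun=> 0)) H.
have {}H c := H (fun _ _ _ => erefl) (fun _ => erefl) c.
have rv0 N : forall c, (dep c < N)%N -> forall j, row_val y c j = 0.
  elim: N => // N IH c cN j.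
  have pv0 : par_val y c = 0.
    rewrite /par_val; case pc: (par c) => [p|//].
    by rewrite IH ?mulr0 //; have := dep_par pc; lia.
  have [_ Hl Hr] := H c.
  have [jp|pj] := leqP j (pos c); first by rewrite Hl // pv0 /= subr0 mul0r.
  have [jM|Mj] := leqP j (M c).+1; first by rewrite Hr // pv0 /= addr0 mul0r.
  by rewrite /row_val ifF //; lia.
move=> w; rewrite row_valE; have [-> _ _] := H (tag w).
by case: eqP => // _; apply: (rv0 (dep (tag w)).+1).
Qed.

Lemma config_basis n (e : cvar -> 'I_n) (e_inj : injective e) rhs B0 :
  is_basis (labelled_lp e a rhs chain_cost B0) (e @: config pos).
Proof.
by apply: labelled_basis => //; [apply: card_config | apply: config_kernel].
Qed.

Variable (sgn : C -> bool).
(* [act c] is the sign passed to the children; for a main component it also tells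
   whether the component itself can be improved. *)
Definition act c := sgn c (+) (pos c == M c).
Hypothesis sgnE : forall c, sgn c = if par c is Some p then act p else true.

Variable y : crow -> rat.
Hypothesis yB : forall v, v \in config pos -> price a y v = chain_cost v.

Lemma cost_left c : chain_cost (mkvar c 0) = - lam c + drift c.
Proof. by rewrite /chain_cost /= inordK. Qed.

Lemma cost_right c : chain_cost (mkvar c (M c).+1) = - lam c - drift c.
Proof. by rewrite /chain_cost /= inordK ?eqxx //; lia. Qed.

Lemma cost_mid c k : (0 < k <= M c)%N -> chain_cost (mkvar c k) = 0.
Proof. by move=> kM; rewrite /chain_cost /= inordK; [rewrite !ifF //; lia | lia]. Qed.

Lemma cost_companion c :
  chain_cost (mkvar c (M c).+2) = if main c then kap * offs c else -1.
Proof.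
rewrite /chain_cost /= inordK; last by lia.
have -> : ((M c).+2 == (M c).+1) = false by lia.
by rewrite eqxx.
Qed.

Lemma cost_slack c : chain_cost (mkvar c (M c).+3) = 0.
Proof. by rewrite /chain_cost /= inordK ?ifF //; lia. Qed.

Definition eff (c : C) := drift c - par_val y c.

Lemma dual_values c :
  [/\ y (mkrow c 0) = 0,
      forall j, (j <= pos c)%N -> row_val y c j = (- lam c + eff c) * j%:R &
      forall j, (pos c < j)%N -> (j <= (M c).+1)%N ->
        row_val y c j = (- lam c - eff c) * ((M c).+1 - j)%:R].
Proof.
have [-> Hl Hr] := dual_chain yB cost_mid cost_slack c.
split=> // j *; [rewrite Hl // cost_left | rewrite Hr // cost_right]; rewrite /eff; ring.
Qed.

Lemma Mr_gt0 c : 0 < (M c)%:R :> rat.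
Proof. by rewrite ltr0n. Qed.

(** The centred value takes only two opposite values. At the root this is due to the choice of
    [eta], at the other main components to [M c = 1]. *)
Lemma top_price c : main c -> eff c = sg (sgn c) * eta c ->
  offs c + row_val y c (M c) = - sg (act c) * kap ^+ dep c.
Proof.
move=> mc effE; have [_ Hl Hr] := dual_values c; have M0 := Mr_gt0 c.
have M1 : (M c)%:R + 1 != 0 :> rat by lra.
have M2 : (M c)%:R != 0 :> rat by lra.
have pM := posM c; rewrite /act.
case pc: (par c) => [p|]; last first.
  have s1 : sgn c by rewrite sgnE pc.
  rewrite (dep_root pc) expr0 mulr1; case: eqVneq => [pE|pN].
    rewrite Hl ?pE // effE s1 /sg /= /offs /lam /eta pc; by field; rewrite M1 M2.
  rewrite Hr //; last by lia.
  rewrite subSnn effE s1 /sg /= /offs /lam /eta pc; by field; rewrite M1 M2.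
have M1' : M c = 1%N by apply: main_bit; rewrite ?pc.
rewrite M1'; case: eqVneq => [pE|pN].
  rewrite Hl ?pE // effE /sg /offs /lam /eta pc M1'; case: (sgn c) => /=; by field.
rewrite Hr //; last by lia.
rewrite effE /sg /offs /lam /eta pc M1' subSnn; case: (sgn c) => /=; by field.
Qed.

(** Induction on the depth: by [top_price] a parent [p] hands down exactly the sign [act p], scaled
    by one more factor [kap]. *)
Lemma effE c : eff c = sg (sgn c) * eta c.
Proof.
suff H N : forall c, (dep c < N)%N -> eff c = sg (sgn c) * eta c by apply: (H (dep c).+1).
elim: N => // N IH {}c cN; rewrite sgnE /eff /drift /par_val /eta.
case pc: (par c) => [p|]; last by rewrite /= mul1r subr0.
have cp := dep_par pc; have := top_price (par_main pc) (IH p ltac:(lia)).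
rewrite cp exprS => H.
have -> : row_val y p (M p) = - sg (act p) * kap ^+ dep p - offs p by rewrite -H; ring.
by ring.
Qed.

Lemma eta_gt0 c : 0 < eta c.
Proof.
have M0 := Mr_gt0 c; rewrite /eta; case: (par c) => [p|]; first exact: exprn_gt0.
by rewrite divr_gt0 ?mulr_gt0 //; lra.
Qed.

Lemma lam_gt0 c : 0 < lam c.
Proof. by have M0 := Mr_gt0 c; rewrite /lam divr_gt0 ?mulr_gt0 ?eta_gt0 //; lra. Qed.

(** When [w_pos] enters, the vertex moves to the right. For sign [1] the value is [lam c] times
    [2 (M c - pos c) - 1], positive exactly when there is room; for sign [-1] it is negative. *)
Lemma rc_first c : chain_cost (mkvar c (pos c)) - price a y (mkvar c (pos c)) =
  lam c * ((M c)%:R - 2 * (pos c)%:R - 1 + sg (sgn c) * (M c)%:R).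
Proof.
have M0 := Mr_gt0 c; have M1 : (M c)%:R != 0 :> rat by lra.
have pM := posM c; have Mc := M_gt0 c.
have [y0 Hl Hr] := dual_values c.
rewrite price_chain; last by lia.
have -> : (pos c == (M c).+2) = false by lia.
have -> : (pos c == (M c).+3) = false by lia.
have -> : (pos c == (M c).+1) = false by lia.
rewrite y0 (Hl (pos c)) // (Hr (pos c).+1) // subSS natrB //.
have E : eff c * ((M c)%:R + 1) = sg (sgn c) * lam c * (M c)%:R.
  by rewrite effE /lam; field.
have [p0|p0] := posnP (pos c).
  rewrite p0 cost_left /= -/(eff c).
  have -> : drift c = eff c + par_val y c by rewrite /eff; ring.
  have -> : row_val y c 0 = 0 by [].
  by rewrite /=; lra.
rewrite cost_mid ?p0 // (Hl (pos c).-1); last by lia.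
have -> : (pos c)%:R = (pos c).-1%:R + 1 :> rat by rewrite natr1 prednK.
by rewrite /=; lra.
Qed.

(** The mirror image: when [w_{pos+1}] enters, the vertex moves to the left. *)
Lemma rc_second c : chain_cost (mkvar c (pos c).+1) - price a y (mkvar c (pos c).+1) =
  lam c * (2 * (pos c)%:R - (M c)%:R - 1 - sg (sgn c) * (M c)%:R).
Proof.
have M0 := Mr_gt0 c; have M1 : (M c)%:R != 0 :> rat by lra.
have pM := posM c; have Mc := M_gt0 c.
have [y0 Hl Hr] := dual_values c.
rewrite price_chain; last by lia.
have -> : ((pos c).+1 == (M c).+2) = false by lia.
have -> : ((pos c).+1 == (M c).+3) = false by lia.
rewrite y0 /= (Hl (pos c)) // (Hr (pos c).+1) // subSS natrB //.
have E : eff c * ((M c)%:R + 1) = sg (sgn c) * lam c * (M c)%:R.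
  by rewrite effE /lam; field.
have [p0|p0] := eqVneq (pos c) (M c).
  rewrite p0 cost_right eqxx.
  have -> : row_val y c (M c).+2 = 0 by rewrite /row_val ifF //; lia.
  have -> : drift c = eff c + par_val y c by rewrite /eff; ring.
  by rewrite /=; lra.
rewrite cost_mid; last by lia.
rewrite (Hr (pos c).+2) ?subSS; [|lia|lia].
have -> : (M c - (pos c).+1)%:R = (M c)%:R - (pos c)%:R - 1 :> rat.
  by rewrite natrB; [rewrite -natr1; ring | lia].
have -> : ((pos c).+1 == (M c).+1) = false by lia.
by rewrite /=; lra.
Qed.

Lemma rc_companion c :
  chain_cost (mkvar c (M c).+2) - price a y (mkvar c (M c).+2) =
  if main c then - (kap * (sg (act c) * kap ^+ dep c)) else -1.
Proof.
have [y0 _ _] := dual_values c.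
rewrite cost_companion price_chain; last by lia.
have -> : ((M c).+2 == (M c).+3) = false by lia.
have -> : ((M c).+2 == (M c).+1) = false by lia.
rewrite y0 /= eqxx.
have -> : row_val y c (M c).+1 = 0 by rewrite /row_val ifF //; lia.
have -> : row_val y c (M c).+2 = 0 by rewrite /row_val ifF //; lia.
have -> : row_val y c (M c).+3 = 0 by rewrite /row_val ifF //; lia.
case mc: (main c) => /=; last by ring.
have := top_price mc (effE c) => H.
have -> : row_val y c (M c) = - sg (act c) * kap ^+ dep c - offs c by rewrite -H; ring.
by ring.
Qed.

Lemma first_improves c :
  (0 < chain_cost (mkvar c (pos c)) - price a y (mkvar c (pos c))) = sgn c && (pos c < M c)%N.
Proof.
rewrite rc_first pmulr_rgt0 ?lam_gt0 // /sg; have pM := posM c.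
have p0 : 0 <= (pos c)%:R :> rat by rewrite ler0n.
case: (sgn c) => /=; last by apply/negbTE; rewrite -leNgt; lra.
case: ltnP => [lt|ge]; first by move: lt; rewrite -(ler_nat rat) -natr1 => ?; lra.
have -> : pos c = M c by lia.
by apply/negbTE; rewrite -leNgt; lra.
Qed.

Lemma second_improves c :
  (0 < chain_cost (mkvar c (pos c).+1) - price a y (mkvar c (pos c).+1)) = ~~ sgn c && (0 < pos c)%N.
Proof.
rewrite rc_second pmulr_rgt0 ?lam_gt0 // /sg; have pM := posM c.
have pMr : (pos c)%:R <= (M c)%:R :> rat by rewrite ler_nat.
case: (sgn c) => /=; first by apply/negbTE; rewrite -leNgt; lra.
case: posnP => [->|lt]; first by apply/negbTE; rewrite -leNgt; lra.
by move: lt; rewrite -(ler_nat rat) => ?; lra.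
Qed.

Lemma companion_improves c :
  (0 < chain_cost (mkvar c (M c).+2) - price a y (mkvar c (M c).+2)) = main c && ~~ act c.
Proof.
rewrite rc_companion; case: (main c) => //=.
have k0 : 0 < kap * kap ^+ dep c by rewrite mulr_gt0 ?exprn_gt0.
by rewrite /sg; case: (act c) => /=; [apply/negbTE; rewrite -leNgt|]; lra.
Qed.

Hypothesis proper : forall c, main c \/ (0 < pos c < M c)%N.

(** By [improvingE], the index of the only improving variable of the component. *)
Definition imp c : nat := if main c && ~~ act c then (M c).+2 else (pos c + ~~ sgn c)%N.

Lemma imp_w c : ~~ (main c && ~~ act c) ->
  if sgn c then (pos c < M c)%N else (0 < pos c)%N.
Proof.
case: (proper c) => [mc|pc _]; last by case: (sgn c); lia.
rewrite mc /= negbK /act; have pM := posM c; have M0 := M_gt0 c.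
case sc: (sgn c) => /=; first by lia.
have -> : M c = 1%N; last by lia.
by apply: main_bit => // pN; move: sc; rewrite sgnE pN.
Qed.

(** An inactive main component has no room in the direction of its sign, and its companion takes
    over; every other component has room in that direction and in no other way improves. *)
Lemma improvingE v : (v \notin config pos) && (0 < chain_cost v - price a y v) =
  (nat_of_ord (tagged v) == imp (tag v)).
Proof.
case: v => c k0; rewrite -(mkvar_tagged (existT _ c k0)) /=; move: (ltn_ord k0).
move: (nat_of_ord k0) => k kM.
rewrite mem_config // !negb_and !negbK inordK // /imp.
have pM := posM c; have := first_improves c; have := second_improves c.
have := companion_improves c; have := @imp_w c.
have nact_pos : main c -> ~~ act c -> (sgn c && (pos c < M c)%N) || (~~ sgn c && (0 < pos c)%N) = false.
  move=> mc; rewrite /act; case sc: (sgn c) => /=; first by rewrite negbK; lia.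
  have M1 : M c = 1%N by apply: main_bit => // pN; move: sc; rewrite sgnE pN.
  by move: pM; rewrite M1; lia.
case mc: (main c && ~~ act c) => /=.
  case/andP: mc => mc ac; have := nact_pos mc ac.
  move=> /norP[/negbTE-> /negbTE->] _ Hc H2 H1.
  case: (eqVneq k (pos c)) => [->|k1]; first by rewrite H1; move: pM; clear; lia.
  case: (eqVneq k (pos c).+1) => [->|k2]; first by rewrite H2; move: pM; clear; lia.
  by case: (eqVneq k (M c).+2) => [->|k3] //=; rewrite Hc.
move=> /(_ isT) Hs Hc H2 H1.
case: (eqVneq k (pos c)) => [->|k1] /=; first by rewrite H1; move: Hs pM; clear; case: (sgn c) => /=; lia.
case: (eqVneq k (pos c).+1) => [->|k2] /=; first by rewrite H2; move: Hs pM; clear; case: (sgn c) => /=; lia.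
case: (eqVneq k (M c).+2) => [->|k3] /=; last by move: k1 k2 k3 pM; clear; case: (sgn c) => /=; lia.
by rewrite Hc; move: pM; clear; case: (sgn c) => /=; lia.
Qed.

Lemma improving_set : [set v | (v \notin config pos) && (0 < chain_cost v - price a y v)] =
  [set mkvar c (imp c) | c in C].
Proof.
have impM c : (imp c < (M c).+4)%N.
  by rewrite /imp; have := posM c; case: ifP => _; case: (sgn c); lia.
apply/setP => v; rewrite inE improvingE; apply/eqP/imsetP => [vi|[c _ ->]].
  by exists (tag v); rewrite // -vi mkvar_tagged.
by rewrite /= inordK.
Qed.

End Dual.

(** * Feasible points of a tree of chains *)

Section Primal.
Variable x : cvar -> rat.
Hypothesis x_rows : forall w, \sum_v a w v * x v = 1.
Local Notation xv := (col_val x).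

Lemma slack_row c : xv c (M c).+2 + xv c (M c).+3 = 1.
Proof. by rewrite -(x_rows (mkrow c 0)) bound_row_chain. Qed.

Lemma chain_rowE c j : (j < M c)%N ->
  second_diff (xv c) j = 1 - (j.+1 == M c)%:R * load x c.
Proof.
by move=> jM; have := x_rows (mkrow c j.+1); rewrite chain_row_chain // => /(canRL (addrK _)).
Qed.

Lemma chain_convex c : `|load x c| <= 1 / 2 -> forall j, (j < M c)%N ->
  1 / 2 <= second_diff (xv c) j <= 3 / 2.
Proof.
rewrite ler_norml => /andP[l1 l2] j jM; rewrite chain_rowE //.
by case: eqP => _ /=; apply/andP; split; lra.
Qed.

(** Induction from the leaves to the roots: children with small loads have end variables at most
    [2 ^+ Mx.+2], and [kap_small] then keeps the load of the parent small. *)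
Lemma load_small :
  (forall c, `|load x c| <= 1 / 2 -> forall k, (k <= (M c).+1)%N ->
     0 <= xv c k <= 2 ^+ (M c).+2) ->
  (forall c, 0 <= xv c (M c).+2 <= 1) ->
  forall c, `|load x c| <= 1 / 2.
Proof.
move=> bnd bndv; pose D := \max_c dep c.
have depD c : (dep c <= D)%N by apply: leq_bigmax.
suff H N : forall c, (D - dep c < N)%N -> `|load x c| <= 1 / 2 by move=> c; apply: (H (D - dep c).+1).
elim: N => // N IH c cN; apply: le_trans kap_small.
rewrite /load normrM gtr0_norm // ler_pM2l //.
apply: le_trans (ler_normB _ _) _; apply: lerD; last first.
  by have /andP[v0 v1] := bndv c; case: (main c); rewrite ?mul1r ?mul0r ?normr0 ?ger0_norm.
apply: le_trans (ler_norm_sum _ _ _) _.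
apply: (@le_trans _ _ (\sum_(c' | par c' == Some c) 2 ^+ Mx.+2)); last first.
  rewrite sumr_const -[leLHS]mulr_natl ler_wpM2r ?exprn_ge0 // ler_nat.
  exact: max_card.
apply: ler_sum => c' /eqP pc'.
have lc' : `|load x c'| <= 1 / 2.
  by apply: IH; have := dep_par pc'; have := depD c'; lia.
have /andP[x0 x1] := bnd c' lc' 0%N isT.
have /andP[z0 z1] := bnd c' lc' (M c').+1 (leqnn _).
have Mb : 2 ^+ (M c').+2 <= 2 ^+ Mx.+2 :> rat.
  by rewrite ler_eXn2l ?ltr1n // !ltnS.
by rewrite ler_norml; apply/andP; split; lra.
Qed.

Hypothesis x_ge0 : forall v, 0 <= x v.
Hypothesis x_tight : forall c, exists2 i, (0 < i <= M c)%N & xv c i = 0.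

Lemma tight_load c : `|load x c| <= 1 / 2.
Proof.
apply: load_small => {}c; last first.
  rewrite x_ge0 /= -(slack_row c) lerDl; exact: x_ge0.
move=> lc k kM; rewrite x_ge0 /=; have [i iM xi] := x_tight c.
apply: (@convex_bound (M c) i) => // [j _|j jM]; first exact: x_ge0.
by case/andP: (chain_convex lc jM).
Qed.

Lemma tight_zeros_adjacent c i i' : (i < i')%N -> (i' <= (M c).+1)%N ->
  xv c i = 0 -> xv c i' = 0 -> i' = i.+1.
Proof.
apply: (@convex_zeros_adjacent (M c)) => [j _|j jM]; first exact: x_ge0.
by case/andP: (chain_convex (tight_load c) jM).
Qed.

End Primal.

(** * Pivots between vertices *)

Section Moves.
Variables (n : nat) (e : cvar -> 'I_n).
Hypothesis e_inj : injective e.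
Variable B0 : {set cvar}.
Local Notation L := (labelled_lp e a (fun=> 1) chain_cost B0).

Lemma config_feasible pos : (forall c, (pos c <= M c)%N) ->
  feasible_basis L (e @: config pos).
Proof.
move=> posM.
have [x [rows out fE]] := labelled_solution e_inj (config_basis posM e_inj (fun=> 1) B0).
have xp c : col_val x c (pos c) = 0.
  by apply: out; rewrite mem_config ?eqxx //; have := posM c; lia.
have xp1 c : col_val x c (pos c).+1 = 0.
  by apply: out; rewrite mem_config ?eqxx ?andbF //; have := posM c; lia.
have xv0 c : col_val x c (M c).+2 = 0.
  by apply: out; rewrite mem_config ?eqxx ?andbF //; lia.
have nonneg c : `|load x c| <= 1 / 2 -> forall k, (k <= (M c).+1)%N -> 0 <= col_val x c k.
  move=> lc; apply: (@convex_nonneg _ (pos c)) => // j jM.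
  by case/andP: (chain_convex rows lc jM).
have small : forall c, `|load x c| <= 1 / 2.
  apply: load_small => // [c lc k kM|c]; last by rewrite xv0 lexx ler01.
  rewrite nonneg //=.
  have [i iM xi] : exists2 i, (0 < i <= M c)%N & col_val x c i = 0.
    have := posM c; have := M_gt0 c; have [p0|p0] := posnP (pos c) => *.
      by exists (pos c).+1; rewrite ?xp1 // p0.
    by exists (pos c); rewrite ?xp ?p0.
  apply: (@convex_bound (M c) i) => // [j jM|j jM]; first exact: nonneg.
  by case/andP: (chain_convex rows lc jM).
apply/fE => v; rewrite -(mkvar_tagged v) -/(col_val x _ _).
have := ltn_ord (tagged v); move: (nat_of_ord (tagged v)) => k; move: (tag v) => c kM.
have [k1|k1] := leqP k (M c).+1; first exact: nonneg.
have [->|k2] := eqVneq k (M c).+2; first by rewrite xv0.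
have -> : k = (M c).+3 by lia.
by have := slack_row rows c; rewrite xv0 add0r => ->.
Qed.

Definition move_pos (pos : C -> nat) (c : C) (s : bool) (c' : C) : nat :=
  if c' == c then (if s then (pos c).+1 else (pos c).-1) else pos c'.

Lemma eq_mkvar v c k : (k < (M c).+4)%N ->
  (v == mkvar c k) = (tag v == c) && (nat_of_ord (tagged v) == k).
Proof.
move=> kM; apply/eqP/andP => [->|[/eqP vc /eqP vk]]; first by rewrite /= inordK.
by rewrite -(mkvar_tagged v) vk vc.
Qed.

(** At the new basic solution any two zeros of a chain are adjacent. The leaving variable adds a
    zero: in another chain it would be a third one, and in [c] it must lie next to the zero that
    stays, on the side away from the entering variable. *)
Lemma leaving_unique pos c (s : bool) j : (forall c, (pos c <= M c)%N) ->
  (if s then (pos c < M c)%N else (0 < pos c)%N) ->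
  j \in e @: config pos ->
  let B' := e (mkvar c (pos c + ~~ s)%N) |: (e @: config pos :\ j) in
  feasible_basis L B' -> B' = e @: config (move_pos pos c s).
Proof.
move=> posM sM /imsetP[u uB ->{j}] B'.
set k := (pos c + ~~ s)%N.
have pMc := posM c.
have kM1 : (k <= (M c).+1)%N by rewrite /k; case: (s); lia.
have kM : (k < (M c).+4)%N by lia.
have ltM c' i : (i <= (M c').+2)%N -> (i < (M c').+4)%N by lia.
have [posM4 posM5] : (forall c', pos c' < (M c').+4)%N /\ (forall c', (pos c').+1 < (M c').+4)%N.
  by split=> c'; have := posM c'; lia.
have -> : B' = e @: (mkvar c k |: (config pos :\ u)).
  rewrite /B' imsetU1; congr (_ |: _); apply/setP => j; rewrite !inE.
  apply/andP/imsetP => [[ju /imsetP[v vB Ej]]|[v]].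
    by exists v => //; rewrite 2!inE vB andbT; apply: contra ju => /eqP <-; rewrite Ej.
  by rewrite 2!inE => /andP[vu vB] ->; rewrite (inj_eq e_inj) imset_f.
move=> fB; have basB : is_basis L (e @: (mkvar c k |: (config pos :\ u))) by case/andP: fB.
have [x [rows out fE]] := labelled_solution e_inj basB.
have x_ge0 := fE.1 fB.
have zero c' k' : (k' < (M c').+4)%N -> (c' != c) || (k' != k) ->
    [|| k' == pos c', k' == (pos c').+1 | k' == (M c').+2] -> col_val x c' k' = 0.
  move=> kM' ne kk; apply: out; rewrite !inE eq_mkvar // /= inordK // negb_or negb_and ne /=.
  by rewrite negb_and; apply/orP; right; move: kk; lia.
have xu : x u = 0.
  apply: out; rewrite !inE eqxx /= orbF; apply/eqP => Eu.
  by move: uB; rewrite Eu mem_config // /k; case: (s); rewrite ?addn0 ?addn1 eqxx ?andbF.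
(* The one of [w_pos] and [w_{pos+1}] that remains nonbasic. *)
set k2 := (if s then (pos c).+1 else pos c).
have xk2 : col_val x c k2 = 0.
  by apply: zero; rewrite /k2 /k; case: (s) sM => /= sM; rewrite ?eqxx ?orbT //; lia.
have tight c' : exists2 i, (0 < i <= M c')%N & col_val x c' i = 0.
  have [->|ne] := eqVneq c' c.
    by exists k2 => //; rewrite /k2; case: (s) sM; lia.
  have := posM c'; have := M_gt0 c'; have [p0|p0] := posnP (pos c') => M0 pM'.
    by exists (pos c').+1; [rewrite p0|apply: zero; rewrite ?ne ?eqxx ?orbT].
  by exists (pos c'); [rewrite p0|apply: zero; rewrite ?ne ?eqxx].
have adj c' i i' : (i <= (M c').+1)%N -> (i' <= (M c').+1)%N -> i != i' ->
    col_val x c' i = 0 -> col_val x c' i' = 0 -> (i' == i.+1) || (i == i'.+1).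
  move=> iM iM'; rewrite neq_ltn => /orP[lt|lt] xi xi'.
    by rewrite (tight_zeros_adjacent rows x_ge0 tight lt iM' xi xi') eqxx.
  by rewrite (tight_zeros_adjacent rows x_ge0 tight lt iM xi' xi) eqxx orbT.
have [uc uk] : tag u = c /\ nat_of_ord (tagged u) = (if s then (pos c).+2 else (pos c).-1).
  move: xu uB (ltn_ord (tagged u)); rewrite -{1 2}(mkvar_tagged u).
  move: (nat_of_ord (tagged u)) => k'; move: (tag u) => c' xu uB kM'.
  move: uB; rewrite mem_config // => /and3P[k1 k3 k4].
  (* The slack cannot leave: its companion is zero, so the slack equals 1. *)
  have [k5|k5] := leqP k' (M c').+1; last first.
    have Ek : k' = (M c').+3 by lia.
    move: xu; rewrite Ek => xs; have := slack_row rows c'; rewrite /col_val xs.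
    have -> : x (mkvar c' (M c').+2) = 0.
      apply: zero; [exact: ltM | | by rewrite eqxx !orbT].
      case: (eqVneq c' c) => [->|_] /=; last by [].
      by apply/eqP => Ek2; move: kM1; rewrite -Ek2 ltnn.
    by rewrite add0r => /eqP; rewrite eq_sym oner_eq0.
  have [Ec|ne] := eqVneq c' c.
    move: k1 k3 k4 k5 xu kM'; rewrite Ec => k1 k3 k4 k5 xu kM'; split=> //.
    have := @adj c k2 k' _ k5 _ xk2 xu; rewrite /k2; case: (s) sM => /= sM; lia.
  have x1 : col_val x c' (pos c') = 0 by apply: zero; rewrite ?ne ?eqxx.
  have x2 : col_val x c' (pos c').+1 = 0 by apply: zero; rewrite ?ne ?eqxx ?orbT.
  have pM' := posM c'.
  have := @adj c' (pos c') k' _ k5 _ x1 xu; have := @adj c' (pos c').+1 k' _ k5 _ x2 xu; lia.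
suff -> : mkvar c k |: (config pos :\ u) = config (move_pos pos c s) by [].
apply/setP => v; rewrite !inE.
rewrite -(mkvar_tagged u) uk uc !eq_mkvar //; last by case: (s); lia.
case: v => c1 k1 /=; move: (nat_of_ord k1) => k' {k1}.
rewrite /move_pos /k; case: (eqVneq c1 c) => [->|ne] //=.
by move: sM pMc; clear; case: s => /=; lia.
Qed.
End Moves.

(** * Chains as well-formed programs *)

Section Program.
Variables (n : nat) (e : cvar -> 'I_n).
Hypothesis e_inj : injective e.

Definition chain_lp (pos0 : C -> nat) : LP n :=
  labelled_lp e a (fun=> 1) chain_cost (config pos0).

(** Take the prices at the vertex where each root is at its right end and all else at the left end.
    All signs below the roots are then negative, so no chain variable improves; raising the value of
    row [0] pays for the companions without affecting the chain variables. *)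
Lemma dual_feasible :
  exists y : crow -> rat, forall v, chain_cost v <= price a y v.
Proof.
pose pos c := if par c is None then M c else 0%N.
pose sgn c := par c == None.
have posM c : (pos c <= M c)%N by rewrite /pos; case: (par c).
have sgnE c : sgn c = if par c is Some p then act pos sgn p else true.
  rewrite /sgn; case: (par c) => [p|//].
  rewrite /act /pos; case: (par p) => [q|] /=; last by rewrite eqxx.
  by case: (M p) (M_gt0 p).
have [y [yB _]] := labelled_improving e_inj (config_basis posM e_inj (fun=> 1) (config pos)).
pose rc c := chain_cost (mkvar c (M c).+2) - price a y (mkvar c (M c).+2).
pose y' (w : crow) := y w + (if nat_of_ord (tagged w) == 0%N then `|rc (tag w)| else 0).
have rvE c j : row_val y' c j = row_val y c j.
  rewrite /row_val; case: ifP => // /andP[j0 jM].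
  by rewrite /y' /= inordK // ifF ?addr0 //; lia.
have prE c k : (k < (M c).+4)%N -> price a y' (mkvar c k) =
    price a y (mkvar c k) + ((k == (M c).+2)%:R + (k == (M c).+3)%:R) * `|rc c|.
  move=> kM; rewrite !price_chain // !rvE.
  have -> : par_val y' c = par_val y c.
    by rewrite /par_val; case: (par c) => // p; rewrite rvE.
  by rewrite /y' /= inordK //=; ring.
exists y' => v; rewrite -(mkvar_tagged v).
have := ltn_ord (tagged v); move: (nat_of_ord (tagged v)) => k; move: (tag v) => c kM {v}.
rewrite prE //.
have b0 : 0 <= ((k == (M c).+2)%:R + (k == (M c).+3)%:R) * `|rc c|.
  by rewrite mulr_ge0 ?addr_ge0 ?ler0n.
have [vB|] := boolP (mkvar c k \in config pos).
  by rewrite (yB _ vB); lra.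
rewrite mem_config // !negb_and !negbK.
move: b0; case: (eqVneq k (M c).+2) => [-> _ _|k2 b0].
  have := ler_norm (rc c); rewrite {1}/rc.
  have -> : ((M c).+2 == (M c).+3) = false by lia.
  by rewrite /=; lra.
rewrite orbF => /orP[]/eqP Ek.
- have : ~~ (sgn c && (pos c < M c)%N).
    by rewrite /sgn /pos; case: (par c) => //=; rewrite ltnn.
  rewrite -(first_improves posM sgnE yB).
  by move: b0; rewrite Ek -leNgt => ? ?; lra.
have : ~~ (~~ sgn c && (0 < pos c)%N) by rewrite /sgn /pos; case: (par c).
rewrite -(second_improves posM sgnE yB).
by move: b0; rewrite Ek -leNgt => ? ?; lra.
Qed.

Lemma chain_lp_well_formed pos0 : (forall c, (pos0 c <= M c)%N) ->
  LP_well_formed (chain_lp pos0).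
Proof.
move=> posM; apply: labelled_well_formed => //.
- exact: config_basis.
- exact: config_feasible.
- exact: dual_feasible.
Qed.

Section Step.
Variables (pos0 pos : C -> nat) (sgn : C -> bool).
Hypothesis posM : forall c, (pos c <= M c)%N.
Hypothesis sgnE : forall c, sgn c = if par c is Some p then act pos sgn p else true.
Hypothesis proper : forall c, main c \/ (0 < pos c < M c)%N.
Local Notation L := (chain_lp pos0).

Lemma improving_config :
  improving L (e @: config pos) = [set e (mkvar c (imp pos sgn c)) | c in C].
Proof.
have [y [yB ->]] := labelled_improving e_inj (config_basis posM e_inj (fun=> 1) (config pos0)).
rewrite (improving_set posM sgnE yB proper).
by rewrite -imset_comp.
Qed.

Lemma card_improving : #|improving L (e @: config pos)| = #|C|.
Proof.
rewrite improving_config card_imset // => c c' /e_inj/(congr1 tag).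
by [].
Qed.

Lemma step_config P (s s' : {set 'I_n} * nat) : s.1 = e @: config pos ->
  simplex_step L P s s' ->
  s'.2 = (P #|C| n s.2).2 /\ exists c,
    kth_smallest (improving L (e @: config pos)) (P #|C| n s.2).1 (e (mkvar c (imp pos sgn c))) /\
    (~~ (main c && ~~ act pos sgn c) -> s'.1 = e @: config (move_pos pos c (sgn c))).
Proof.
move=> sE [_ [_ [i [j [kth [jB [s'E [fs' s'2]]]]]]]].
move: kth jB s'E s'2; rewrite sE card_improving => kth jB s'E s'2; split=> //.
have /imsetP[c _ Ei] : i \in [set e (mkvar c (imp pos sgn c)) | c in C].
  by rewrite -improving_config; case/andP: kth.
exists c; rewrite -Ei; split=> // wc.
have sM := imp_w posM sgnE proper wc.
move: fs'; rewrite s'E Ei {1 2}/imp (negbTE wc) => fs'.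
exact: (leaving_unique e_inj posM sM jB fs').
Qed.
End Step.
End Program.
End ChainDynamics.

(** * Ranks and counters *)

Lemma order_embedding (V : finType) (f : V -> nat) (flipped : bool) n : (#|V| <= n)%N ->
  exists2 e : V -> 'I_n, injective e &
    forall u v, (f u < f v)%N -> (if flipped then e v < e u else e u < e v)%N.
Proof.
(* Ties of [f] are broken by [enum_rank]. *)
move=> Vn; pose key v := (f v * #|V| + enum_rank v)%N.
have key_mono u v : (f u < f v)%N -> (key u < key v)%N.
  move=> fuv; apply: leq_trans (_ : (f u).+1 * #|V| <= _)%N.
    by rewrite /key mulSn addnC ltn_add2r.
  by apply: leq_trans (leq_addr _ _); rewrite leq_mul2r fuv orbT.
have key_inj : injective key.
  move=> u v kuv; apply: enum_rank_inj; apply: val_inj => /=.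
  by have := congr1 (modn^~ #|V|) kuv; rewrite /key !modnMDl !modn_small.
pose lt u v := if flipped then (key v < key u)%N else (key u < key v)%N.
have lt_trans u v w : lt u v -> lt v w -> lt u w by rewrite /lt; case: (flipped); lia.
have lt_irr u : lt u u = false by rewrite /lt; case: (flipped); rewrite ltnn.
have lt_tot u v : u != v -> lt u v || lt v u.
  by rewrite -(inj_eq key_inj) /lt; case: (flipped); lia.
pose rk v := #|[set u | lt u v]|.
have rkn v : (rk v < n)%N.
  apply: leq_trans Vn; rewrite /rk -cardsT; apply: proper_card.
  by apply/properP; split; [apply: subsetT | exists v; rewrite !inE ?lt_irr].
have rk_mono u v : lt u v -> (rk u < rk v)%N.
  move=> luv; apply: proper_card; apply/properP; split.
    by apply/subsetP => w; rewrite !inE => /lt_trans; apply.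
  by exists u; rewrite inE // lt_irr.
exists (fun v => Ordinal (rkn v)).
  move=> u v /(congr1 val) /= rkuv; apply/eqP/negPn/negP => /lt_tot.
  by case/orP => /rk_mono; rewrite rkuv ltnn.
move=> u v /key_mono kuv; have := @rk_mono u v; have := @rk_mono v u.
by rewrite /lt; case: (flipped); [move=> /(_ kuv) | move=> _ /(_ kuv)].
Qed.

Lemma kth_smallest_unique n (C : finType) (g : C -> 'I_n) k c c0 : injective g ->
  #|[set c' | (g c' < g c0)%N]| = k.-1 ->
  kth_smallest [set g c | c in C] k (g c) -> c = c0.
Proof.
move=> g_inj card0 /andP[_ /eqP cardc].
have E : #|[set j in [set g c | c in C] | (j < g c)%N]| = #|[set c' | (g c' < g c)%N]|.
  rewrite -(card_imset _ g_inj); apply: eq_card => j; rewrite inE.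
  apply/andP/imsetP => [[/imsetP[c' _ ->] lt]|[c']]; first by exists c'; rewrite ?inE.
  by rewrite inE => lt ->; rewrite imset_f.
have mono c1 c2 : (g c1 < g c2)%N -> (#|[set c' | (g c' < g c1)%N]| < #|[set c' | (g c' < g c2)%N]|)%N.
  move=> lt; apply: proper_card; apply/properP; split.
    by apply/subsetP => c'; rewrite !inE => /ltn_trans; apply.
  by exists c1; rewrite !inE ?ltnn.
have {}cardc : #|[set c' | (g c' < g c)%N]| = k.-1 by rewrite -E.
by apply: g_inj; apply: val_inj; case: (ltngtP (g c) (g c0)) => // /mono; rewrite cardc card0 ltnn.
Qed.

(** Here [Cy] stands for the ranks chosen periodically and [Vi] for all ranks ever chosen. The ranks
    outside [Vi] fall into [#|Cy| + 1] gaps, one after each element of [Cy] and one before the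
    first; they cannot all have fewer than [d] elements. The initial gap is the reversed case. *)
Lemma slot_choice K (Cy Vi : {set 'I_K}) (q0 : 'I_K) d :
  q0 \in Cy -> Cy \subset Vi -> (0 < d)%N -> (#|Vi| + #|Vi|.+1 * d <= K)%N ->
  exists (flipped : bool) (r : 'I_K) (P : {set 'I_K}),
  [/\ r \in Cy, (d <= #|P|)%N, [disjoint P & Vi] &
    forall p, p \in P -> if flipped then (p < r)%N /\ forall q, q \in Cy -> (r <= q)%N \/ (q < p)%N
                         else (r < p)%N /\ forall q, q \in Cy -> (q <= r)%N \/ (p < q)%N].
Proof.
move=> q0C CyVi d0 dK.
pose cls (r : 'I_K) := [set u in ~: Vi | (r < u)%N && [forall q in Cy, (q <= r)%N || (u < q)%N]].
pose low := [set u in ~: Vi | [forall q in Cy, (u < q)%N]].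
have disj (A : {set 'I_K}) : A \subset ~: Vi -> [disjoint A & Vi].
  by rewrite disjoints_subset.
have [/existsP[r /andP[rC cr]]|/existsPn small] := boolP [exists r in Cy, d <= #|cls r|]%N.
  exists false, r, (cls r); split=> //; first by apply: disj; apply/subsetP => u; rewrite inE => /andP[].
  move=> p; rewrite inE => /and3P[_ rp /forall_inP H]; split=> // q /H /orP[]; by [left|right].
have [lowd|lowd] := leqP d #|low|.
  case: (arg_minnP (fun q : 'I_K => nat_of_ord q) q0C) => r rC rmin.
  exists true, r, low; split=> //; first by apply: disj; apply/subsetP => u; rewrite inE => /andP[].
  by move=> p; rewrite inE => /andP[_ /forall_inP H]; split; [apply: H | left; apply: rmin].
have cover : ~: Vi \subset low :|: \bigcup_(r in Cy) cls r.
  apply/subsetP => u uV; rewrite in_setU.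
  have [ulow|] := boolP [forall q in Cy, (u < q)%N]; first by rewrite inE uV ulow.
  rewrite negb_forall => /existsP[q1]; rewrite negb_imply -leqNgt => /andP[q1C q1u].
  have q1P : (q1 \in Cy) && (q1 <= u)%N by rewrite q1C.
  case: (@arg_maxnP _ q1 (fun q => (q \in Cy) && (q <= u)%N) (fun q : 'I_K => nat_of_ord q) q1P) => r /andP[rC ru] rmax.
  apply/orP; right; apply/bigcupP; exists r => //; rewrite inE uV /=; apply/andP; split.
    rewrite ltn_neqAle ru andbT; apply/eqP => /val_inj Er.
    by move: uV; rewrite inE -Er (subsetP CyVi).
  apply/forall_inP => q qC; have [//|uq] := ltnP u q; first by rewrite orbT.
  by apply/orP; left; apply: rmax; rewrite qC.
have cU : (#|~: Vi| <= #|low| + #|Cy| * d.-1)%N.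
  apply: leq_trans (subset_leq_card cover) _; rewrite cardsU.
  apply: leq_trans (leq_subr _ _) _; rewrite leq_add2l.
  apply: leq_trans (_ : \sum_(r in Cy) #|cls r| <= _)%N.
    elim/big_rec2: _ => [|r A m _ IH]; first by rewrite cards0.
    by rewrite cardsU; apply: leq_trans (leq_subr _ _) _; rewrite leq_add2l.
  rewrite -sum_nat_const; apply: leq_sum => r rC; have := small r; rewrite rC /=; lia.
have := cardsC Vi; rewrite card_ord => cV; have := subset_leq_card CyVi; nia.
Qed.

(** * Binary expansions and alternating sums *)

Definition bit (x i : nat) : bool := odd (x %/ 2 ^ i)%N.

Lemma bit0 x : bit x 0 = odd x.
Proof. by rewrite /bit expn0 divn1. Qed.

Lemma bitS x i : bit x i.+1 = bit x./2 i.
Proof. by rewrite /bit expnS divnMA divn2. Qed.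

Lemma bit_succ x i : (forall j, (j < i)%N -> bit x j) -> ~~ bit x i ->
  forall j, bit x.+1 j = (j == i) || ((i < j)%N && bit x j).
Proof.
elim: i x => [|i IH] x low zero [|j].
- by rewrite !bit0 /= in zero *.
- rewrite !bitS /=; move: zero; rewrite bit0 => ev.
  by rewrite uphalf_half (negbTE ev).
- by rewrite bit0 /= -bit0 low.
rewrite !bitS /= uphalf_half -(bit0 x) low // add1n eqSS ltnS IH // => [k ki|].
  by rewrite -bitS low.
by rewrite -bitS.
Qed.

Lemma exists_zero_bit x d : (x < 2 ^ d - 1)%N ->
  exists2 i, (i < d)%N & ~~ bit x i /\ forall j, (j < i)%N -> bit x j.
Proof.
elim: d x => [|d IH] x xd; first by rewrite expn0 in xd.
have [ox|ex] := boolP (odd x); last by exists 0%N; rewrite ?bit0.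
have [|i id [zi oi]] := IH x./2; first by move: xd (odd_double_half x); rewrite ox expnS; lia.
exists i.+1; rewrite // bitS; split=> // -[|j] ji; first by rewrite bit0.
by rewrite bitS; apply: oi.
Qed.

(** Since [s] is an odd multiple of [2 ^ logn 2 s], adding it changes the parity of the quotient by
    this power. *)
Lemma bit_add_logn x s : (0 < s)%N -> bit (x + s) (logn 2 s) = ~~ bit x (logn 2 s).
Proof.
move=> s0; have [m om Es] := pfactor_coprime (isT : prime 2) s0.
rewrite /bit {1}Es divnDMl ?expn_gt0 // oddD; move: om; rewrite coprime2n => ->.
by rewrite addbT.
Qed.

(** Beyond [t0] any [2 * p] consecutive terms cancel, so every partial sum already occurs early. *)
Lemma alternating_sum (f : nat -> int) (t0 p : nat) :
  (forall t, (t0 <= t)%N -> f (t + p)%N = - f t) ->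
  forall t, exists2 t', (t' <= t0 + 2 * p)%N & \sum_(i < t) f i = \sum_(i < t') f i.
Proof.
move=> fp; elim/ltn_ind=> t IH.
have [tle|tgt] := leqP t (t0 + 2 * p)%N; first by exists t.
have [p0|p_gt0] := posnP p.
  have f0 i : (t0 <= i)%N -> f i = 0 by move=> /fp; rewrite p0 addn0; lia.
  exists t0; first by lia.
  have t0t : (t0 <= t)%N by lia.
  rewrite -(subnKC t0t) big_split_ord /= [X in _ + X]big1 ?addr0 // => i _.
  by apply: f0; lia.
have [|t' t'le E] := IH (t - 2 * p)%N; first by lia.
exists t' => //; rewrite -E.
have Et : t = ((t - 2 * p) + (p + p))%N by lia.
have -> : \sum_(i < t) f i = \sum_(i < (t - 2 * p) + (p + p)) f i by rewrite -Et.
rewrite big_split_ord /= [X in _ + X]big_split_ord /=.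
rewrite -big_split /= [X in _ + X]big1 ?addr0 // => i _.
have -> : (t - 2 * p + (p + i) = (t - 2 * p + i) + p)%N by lia.
by rewrite fp ?subrr //; lia.
Qed.

Lemma card_ord_ltn K m : (m <= K)%N -> #|[set c : 'I_K | (c < m)%N]| = m.
Proof.
move=> mK; have inj : injective (widen_ord mK).
  by move=> c c' E; apply: val_inj; have := congr1 val E.
rewrite -[RHS]card_ord -(card_imset _ inj).
apply: eq_card => c; rewrite inE; apply/idP/imsetP => [cm|[c' _ ->]] /=; last exact: ltn_ord.
by exists (Ordinal cm) => //; apply: val_inj.
Qed.

Lemma card_cvar (C : finType) (M : C -> nat) : #|{: cvar M}| = (\sum_c (M c).+4)%N.
Proof.
rewrite card_tagged sumnE big_map big_enum /=.
by apply: eq_bigr => c _; rewrite card_ord.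
Qed.

Lemma card_crow (C : finType) (M : C -> nat) : #|{: crow M}| = (\sum_c (M c).+1)%N.
Proof.
rewrite card_tagged sumnE big_map big_enum /=.
by apply: eq_bigr => c _; rewrite card_ord.
Qed.

(** * The program attached to a sequence of ranks *)

Section Schedule.
Local Open Scope nat_scope.
Variables (K : nat) (rho : nat -> 'I_K) (t1 p : nat) (r : 'I_K) (P : {set 'I_K}).
Hypothesis rho_t1 : rho t1 = r.
Hypothesis rho_per : forall t, t1 <= t -> rho (t + p) = rho t.
Hypothesis p_gt0 : 0 < p.
Hypothesis P_above : forall q, q \in P -> r < q.
Hypothesis rho_P : forall t, rho t \notin P.
Hypothesis rho_gap : forall t q, t1 <= t -> q \in P -> rho t <= r \/ q < rho t.

Definition visits (q : 'I_K) (t : nat) : nat := \sum_(i < t) (rho i == q).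
Definition per_period : nat := visits r (t1.+1 + p) - visits r t1.+1.
Definition lvl : nat := logn 2 per_period.

Definition bits : seq 'I_K := enum P.
Definition lev (q : 'I_K) : nat := index q bits.
Definition slot (i : nat) : 'I_K := nth r bits i.
Definition horizon : nat := t1.+1 + 2 * p.

(* The slots are the ranks: [r] is the root chain, the elements of [P] are the bits
   (the parent of a bit is the next one, and [slot #|P|] is [r]), and every other
   slot is a chain attached to the bit number [lvl]. *)
Definition smain (c : 'I_K) : bool := (c == r) || (c \in P).
Definition spar (c : 'I_K) : option 'I_K :=
  if c == r then None else Some (slot (if c \in P then (lev c).+1 else lvl)).
Definition sdep (c : 'I_K) : nat :=
  if c == r then 0 else if c \in P then #|P| - lev c else (#|P| - lvl).+1.
(** The root reaches its end with the choice made at time [t1]. A chain outside the counter gets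
    room for [visits c horizon] moves on either side of its middle, which suffices by
    [disp_bound]. *)
Definition slen (c : 'I_K) : nat :=
  if c == r then visits r t1.+1 else if c \in P then 1 else (visits c horizon).*2.+2.

Definition count (t : nat) : nat := visits r t - visits r t1.+1.
(** Active bits are the zeros of the counter: flipping the lowest active one adds 1. *)
Definition bact (i t : nat) : bool := (t1 < t) && ~~ bit (count t) i.
Definition sact (c : 'I_K) (t : nat) : bool := if c == r then t <= t1 else bact (lev c) t.
Definition ssgn (t : nat) (c : 'I_K) : bool := if spar c is Some q then sact q t else true.

Definition disp (q : 'I_K) (i : nat) : int :=
  if rho i == q then (if bact lvl i then 1 else -1)%R else 0%R.
(** The vertex at time [t] in closed form. For a bit, the formula inverts the definition of
    [act]. *)
Definition spos (t : nat) (c : 'I_K) : nat :=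
  if c == r then visits r (minn t t1.+1) else
  if c \in P then nat_of_bool (sact c t (+) ssgn t c) else
  `|((visits c horizon).+1%:Z + \sum_(i < t) disp c i)%R|%N.

Lemma visitsS q t : visits q t.+1 = visits q t + (rho t == q).
Proof. by rewrite /visits big_ord_recr. Qed.

Lemma visits_mono q t t' : t <= t' -> visits q t <= visits q t'.
Proof. by move=> /subnK <-; elim: (t' - t) => // k IH; rewrite addSn visitsS; lia. Qed.

Lemma visits_le q t : visits q t <= t.
Proof. by elim: t => [|t IH]; [rewrite /visits big_ord0 | rewrite visitsS; case: eqP; lia]. Qed.

Lemma sum_visits t : \sum_(q < K) visits q t = t.
Proof.
rewrite exchange_big /= -[RHS]card_ord -sum1_card; apply: eq_bigr => i _.
rewrite (bigD1 (rho i)) //= eqxx big1 // => q qi.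
by rewrite eq_sym (negbTE qi).
Qed.

Lemma r_notin_P : r \notin P.
Proof. by apply/negP => /P_above; rewrite ltnn. Qed.

Lemma size_bits : size bits = #|P|.
Proof. by rewrite -cardE. Qed.

Lemma lev_lt q : q \in P -> lev q < #|P|.
Proof. by rewrite -size_bits index_mem mem_enum. Qed.

Lemma slot_lev q : q \in P -> slot (lev q) = q.
Proof. by move=> qP; rewrite /slot nth_index // mem_enum. Qed.

Lemma slot_in i : i < #|P| -> slot i \in P.
Proof. by move=> iP; rewrite -mem_enum mem_nth // size_bits. Qed.

Lemma lev_slot i : i < #|P| -> lev (slot i) = i.
Proof. by move=> iP; rewrite /lev index_uniq ?enum_uniq // size_bits. Qed.

Lemma slot_out i : #|P| <= i -> slot i = r.
Proof. by move=> iP; rewrite /slot nth_default // size_bits. Qed.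

Lemma P_neq_r q : q \in P -> (q == r) = false.
Proof. by move=> qP; apply: contraTF qP => /eqP->; apply: r_notin_P. Qed.

Lemma per_period_gt0 : 0 < per_period.
Proof.
rewrite /per_period subn_gt0.
have -> : t1.+1 + p = (t1 + p).+1 by lia.
by rewrite (visitsS r (t1 + p)) rho_per // rho_t1 eqxx addn1 ltnS; apply: visits_mono; lia.
Qed.

Lemma visits_period t : t1 < t -> visits r (t + p) = visits r t + per_period.
Proof.
move=> /subnK <-; elim: (t - t1.+1) => [|k IH].
  by rewrite add0n /per_period subnKC //; apply: visits_mono; lia.
rewrite !addSn !visitsS IH rho_per; lia.
Qed.

Lemma count_period t : t1 < t -> count (t + p) = count t + per_period.
Proof.
move=> tt; rewrite /count visits_period //.
by rewrite addnBAC //; apply: visits_mono.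
Qed.

(** A period adds [per_period] to the counter, which flips its bit [lvl], and with it the direction
    of the chains attached there. *)
Lemma disp_period q t : t1.+1 <= t -> disp q (t + p) = (- disp q t)%R.
Proof.
move=> tt; rewrite /disp rho_per; last by lia.
case: eqP => // _; rewrite /bact count_period // /lvl bit_add_logn ?per_period_gt0 // tt.
have -> : t1 < t + p by lia.
by case: (bit _ _).
Qed.

Lemma disp_bound q t : (`|\sum_(i < t) disp q i| <= (visits q horizon)%:Z)%R.
Proof.
have [t' t't ->] := alternating_sum (disp_period q) t.
apply: le_trans (_ : (visits q t')%:Z <= _)%R; last by rewrite lez_nat visits_mono.
elim: (t') => [|k IH]; first by rewrite big_ord0.
rewrite big_ord_recr /= visitsS; move: IH; move: (\sum_(i < k) disp q i)%R => S.
by rewrite /disp; case: eqP => _; [case: bact|]; lia.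
Qed.

Lemma sposE t c : c != r -> c \notin P ->
  ((spos t c)%:Z = (visits c horizon).+1%:Z + \sum_(i < t) disp c i)%R.
Proof.
move=> cr cP; rewrite /spos (negbTE cr) (negbTE cP).
by have := disp_bound c t; lia.
Qed.

Lemma slen_gt0 c : 0 < slen c.
Proof.
rewrite /slen; case: eqP => // _; last by case: ifP.
by rewrite visitsS rho_t1 eqxx addn1.
Qed.

Lemma slen_le c : slen c <= (visits c horizon).*2.+2.
Proof.
rewrite /slen; case: eqP => [->|_]; last by case: ifP.
have : visits r t1.+1 <= visits r horizon by apply: visits_mono; rewrite /horizon; lia.
lia.
Qed.

Hypothesis lvl_lt : lvl < #|P|.

Lemma spar_main c q : spar c = Some q -> smain q.
Proof.
rewrite /spar; case: eqP => // _ [<-]; rewrite /smain; set i := if _ then _ else _.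
have [iP|iP] := ltnP i #|P|; first by rewrite slot_in ?orbT.
by rewrite slot_out ?eqxx.
Qed.

Lemma sdep_par c q : spar c = Some q -> sdep c = (sdep q).+1.
Proof.
rewrite /spar /sdep; case: eqP => // _ [<-]; case: ifP => cP; last first.
  by rewrite P_neq_r ?slot_in // lev_slot.
have lc := lev_lt cP; have [lt|ge] := ltnP (lev c).+1 #|P|.
  by rewrite P_neq_r ?slot_in // lev_slot //; lia.
by rewrite slot_out // eqxx; lia.
Qed.

Lemma sdep_root c : spar c = None -> sdep c = 0.
Proof. by rewrite /spar /sdep; case: eqP. Qed.

Lemma smain_bit c : smain c -> spar c <> None -> slen c = 1.
Proof. by rewrite /smain /spar /slen; case: eqP => //= _ ->. Qed.

Lemma spos_r_end t : (spos t r == slen r) = (t1 < t).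
Proof.
rewrite /spos /slen eqxx; have [tt|tt] := ltnP t1 t.
  by rewrite (minn_idPr tt) eqxx.
rewrite (minn_idPl _); last by lia.
apply/negbTE; rewrite neq_ltn; apply/orP; left.
rewrite (visitsS r t1) rho_t1 eqxx addn1 ltnS; exact: visits_mono.
Qed.

Lemma sactE t c : smain c -> act slen (spos t) (ssgn t) c = sact c t.
Proof.
rewrite /smain /act; case: eqVneq => [->|cr] /= cP.
  by rewrite spos_r_end /ssgn /spar /sact eqxx /=; case: ltnP.
rewrite /spos /slen (negbTE cr) cP; case: (sact c t); by case: (ssgn t c).
Qed.

Lemma ssgnE t c : ssgn t c = if spar c is Some q then act slen (spos t) (ssgn t) q else true.
Proof. by rewrite {1}/ssgn; case pc: (spar c) => [q|//]; rewrite sactE // (spar_main pc). Qed.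

Lemma sproper t c : smain c \/ 0 < spos t c < slen c.
Proof.
case mc: (smain c); first by left.
move/negbT: mc; rewrite /smain negb_or => /andP[cr cP]; right.
have := disp_bound c t; have := sposE t cr cP; rewrite /slen (negbTE cr) (negbTE cP); lia.
Qed.

Lemma spos_le t c : spos t c <= slen c.
Proof.
have [mc|/andP[_ /ltnW//]] := sproper t c.
move: mc; rewrite /smain /spos /slen; case: eqVneq => [_|cr] /=.
  by move=> _; apply: visits_mono; apply: geq_minr.
by move=> ->; case: (_ (+) _).
Qed.

Lemma sact_slot i t : sact (slot i) t = if i < #|P| then bact i t else t <= t1.
Proof.
rewrite /sact; case: ltnP => iP; last by rewrite slot_out // eqxx.
by rewrite P_neq_r ?slot_in // lev_slot.
Qed.

Lemma ssgn_bit t c : c \in P -> ssgn t c = sact (slot (lev c).+1) t.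
Proof. by move=> cP; rewrite /ssgn /spar P_neq_r // cP. Qed.

Lemma ssgn_chain t c : c != r -> c \notin P -> ssgn t c = bact lvl t.
Proof.
by move=> cr cP; rewrite /ssgn /spar (negbTE cr) (negbTE cP) sact_slot lvl_lt.
Qed.

Lemma spos_bit t c : c \in P -> spos t c = sact c t (+) sact (slot (lev c).+1) t.
Proof. by move=> cP; rewrite /spos P_neq_r // cP ssgn_bit. Qed.

Lemma spos_chain_stay t c : c != r -> c \notin P -> rho t != c -> spos t.+1 c = spos t c.
Proof.
move=> cr cP rc; have := sposE t.+1 cr cP; have := sposE t cr cP.
rewrite big_ord_recr /=; have -> : disp c t = 0%R by rewrite /disp (negbTE rc).
by move: (\sum_(i < t) disp c i)%R => S; lia.
Qed.

Lemma countS t : t1 < t -> count t.+1 = count t + (rho t == r).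
Proof. by move=> tt; rewrite /count visitsS addnBAC //; apply: visits_mono. Qed.

Lemma count_lt t : t1 < t -> count t < t.
Proof. by move=> tt; rewrite /count; have := visits_le r t; have := slen_gt0 r; rewrite /slen eqxx; lia. Qed.

Lemma bact_stay i t : rho t != r -> bact i t.+1 = bact i t.
Proof.
move=> rt; rewrite /bact; have [tt|tt] := ltnP t1 t.
  by rewrite countS // (negbTE rt) addn0; have -> : t1 < t.+1 by lia.
have -> : (t1 < t.+1) = false; last by [].
by apply/negbTE; rewrite -leqNgt ltn_neqAle tt andbT; apply: contraNneq rt => ->; rewrite rho_t1.
Qed.

Lemma sact_stay c t : rho t != r -> sact c t.+1 = sact c t.
Proof.
move=> rt; rewrite /sact; case: eqP => _; last exact: bact_stay.
have : t != t1 by apply: contraNneq rt => ->; rewrite rho_t1.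
lia.
Qed.

Lemma spos_next_chain t q : q = rho t -> q != r ->
  forall c, spos t.+1 c = move_pos (spos t) q (ssgn t q) c.
Proof.
move=> qE qr c; have qP : q \notin P by rewrite qE.
have rt : rho t != r by rewrite -qE.
rewrite /move_pos; case: eqVneq => [->|cq].
  have := sposE t.+1 qr qP; have := sposE t qr qP; have := sproper t q.
  rewrite /smain (negbTE qr) (negbTE qP) => -[//|].
  have dq : disp q t = (if bact lvl t then 1 else -1)%R by rewrite /disp -qE eqxx.
  rewrite big_ord_recr /= dq ssgn_chain //; move: (\sum_(i < t) disp q i)%R => S.
  by case: (bact lvl t); lia.
have [->|cr] := eqVneq c r.
  rewrite /spos eqxx; have [tt|tt] := leqP t t1.
    have : t != t1 by apply: contraNneq rt => ->; rewrite rho_t1.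
    move=> tn; rewrite (minn_idPl _) ?(minn_idPl _) //; try lia.
    by rewrite visitsS (negbTE rt) addn0.
  by rewrite !(minn_idPr _) //; lia.
have [cP|cP] := boolP (c \in P); first by rewrite !spos_bit // !sact_stay.
by apply: spos_chain_stay => //; rewrite -qE eq_sym.
Qed.

Lemma spos_next_start t : rho t = r -> t <= t1 ->
  forall c, spos t.+1 c = move_pos (spos t) r (ssgn t r) c.
Proof.
move=> rt tt c; rewrite /move_pos; case: eqVneq => [->|cr].
  have -> : ssgn t r by rewrite /ssgn /spar eqxx.
  rewrite /spos eqxx !(minn_idPl _) //; last by lia.
  by rewrite visitsS rt eqxx addn1.
have [cP|cP] := boolP (c \in P); last first.
  by apply: spos_chain_stay => //; rewrite rt eq_sym.
rewrite !spos_bit // !sact_slot /sact P_neq_r // /bact.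
have [lt|ge] := ltnP t t1.
  have -> : (t1 < t.+1) = false by lia.
  have -> : (t1 < t) = false by lia.
  by have -> : t <= t1 by lia.
(* At time [t1] all activities are complemented at once: the root falls asleep and every bit wakes
   up. The positions of the bits, being exclusive ors of two activities, do not change. *)
have -> : t = t1 by lia.
have c0 : count t1.+1 = 0 by rewrite /count subnn.
by rewrite c0 /bit !div0n ltnSn ?ltnn leqnn /=; case: ifP.
Qed.

(** Adding 1 complements the bits [0] to [i]. The exclusive or of two successive activities then
    changes at level [i] only, so a single vertex moves. *)
Lemma spos_next_bit t i : rho t = r -> t1 < t -> i < #|P| -> ~~ bit (count t) i ->
  (forall j, j < i -> bit (count t) j) ->
  forall c, spos t.+1 c = move_pos (spos t) (slot i) (ssgn t (slot i)) c.
Proof.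
move=> rt tt iP zi oi c.
have bS j : bit (count t.+1) j = (j == i) || ((i < j) && bit (count t) j).
  by rewrite countS // rt eqxx addn1; apply: bit_succ.
have tt' : t1 < t.+1 by lia.
have ge0 : (t <= t1) = false by lia.
have ge1 : (t.+1 <= t1) = false by lia.
have [cP|cP] := boolP (c \in P); last first.
  have cs : (c == slot i) = false by apply: contraNF cP => /eqP->; apply: slot_in.
  rewrite /move_pos cs; have [->|cr] := eqVneq c r.
    by rewrite /spos eqxx !(minn_idPr _).
  by apply: spos_chain_stay => //; rewrite rt eq_sym.
have -> : move_pos (spos t) (slot i) (ssgn t (slot i)) c =
    (if lev c == i then (if ssgn t c then (spos t c).+1 else (spos t c).-1) else spos t c).
  rewrite /move_pos; case: (eqVneq c (slot i)) => [->|ci]; first by rewrite lev_slot // eqxx.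
  by rewrite ifF //; apply: contraNF ci => /eqP <-; rewrite slot_lev.
rewrite ssgn_bit // !spos_bit // !sact_slot /sact P_neq_r // /bact tt tt' ge0 ge1 !bS.
case: (ltngtP (lev c) i) => [ji|ij|ji] /=.
- rewrite (oi _ ji) /=; case: (ltngtP (lev c).+1 i) => [ji'|ij'|ji'] /=.
  + have -> : (lev c).+1 < #|P| by lia.
    by rewrite (oi _ ji').
  + by lia.
  + by rewrite ji' iP zi.
- have -> : ((lev c).+1 == i) = false by lia.
  by have -> : i < (lev c).+1 by lia.
rewrite ji ?eqxx ?ltnn /= zi ltnSn.
have -> : (i.+1 == i) = false by lia.
by case: ifP => _ /=; case: (bit _ _).
Qed.

(* Ranges of the variable order: all bits sit at slot [r] (lowest bit first), their
   companions at their own slots, and the companion of the root after the last bit.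
   The flag tells a chain variable from a companion. *)
Definition key_slot (c : 'I_K) (w : bool) : nat :=
  if w then (if c == r then r * K.+2 else if c \in P then r * K.+2 + (lev c).+1 else c * K.+2)
  else (if c == r then (\max_(q in P) q) * K.+2 + 1 else c * K.+2).

Definition skey (t : nat) (c : 'I_K) : nat := key_slot c (~~ (smain c && ~~ sact c t)).

Lemma skeyE t c : skey t c =
  if c == r then (if t <= t1 then r * K.+2 else (\max_(q in P) q) * K.+2 + 1) else
  if c \in P then (if bact (lev c) t then r * K.+2 + (lev c).+1 else c * K.+2) else c * K.+2.
Proof.
rewrite /skey /key_slot /smain /sact; case: eqP => [//|cr] /=; first by case: (t <= t1).
by case: (c \in P) => //=; case: bact.
Qed.

(** The last condition says that exactly [rho t] improving variables precede that of [c0]. When [r]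
    is chosen after [t1], [c0] is the lowest active bit: lower bits are represented by companions at
    their own slots beyond [r], and higher active bits come later within slot [r]. *)
Lemma target t : (t1 < t -> count t < 2 ^ #|P| - 1) ->
  exists c0, [/\ ~~ (smain c0 && ~~ sact c0 t),
    forall c, spos t.+1 c = move_pos (spos t) c0 (ssgn t c0) c,
    rho t <= c0 &
    forall c, c != c0 -> if c < rho t then skey t c < skey t c0 else skey t c0 < skey t c].
Proof.
move=> valid; have PK : #|P| <= K by rewrite -[K in _ <= K]card_ord max_card.
set z := \max_(q in P) q.
have zP q : q \in P -> q <= z by move=> qP; apply: (@leq_bigmax_cond _ (mem P) _ q qP).
have rz : r < z by apply: leq_trans (zP _ (slot_in lvl_lt)); apply: P_above; apply: slot_in.
have multS (u v : nat) w : u < v -> w < K.+2 -> u * K.+2 + w < v * K.+2.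
  by move=> uv wK; apply: leq_trans (_ : u.+1 * K.+2 <= _); [rewrite mulSn addnC ltn_add2r|rewrite leq_mul2r uv orbT].
have mult u v : u < v -> u * K.+2 < v * K.+2 by move=> uv; have := @multS u v 0 uv isT; rewrite addn0.
have levK c : c \in P -> (lev c).+1 < K.+2 by move=> /lev_lt; lia.
have [tt|tt] := leqP t t1.
  have keyc c : skey t c = c * K.+2.
    rewrite skeyE tt; case: eqP => [->//|_]; rewrite /bact.
    have -> : (t1 < t) = false by lia.
    by case: ifP.
  exists (rho t); split=> //.
  - rewrite /smain (negbTE (rho_P t)) orbF negb_and /sact; by case: eqP => //= _; rewrite tt.
  - move=> c; have [rr|rr] := eqVneq (rho t) r; last by apply: spos_next_chain.
    by rewrite rr; apply: spos_next_start.
  move=> c cr; rewrite !keyc; case: ltnP => [/mult//|ge]; apply: mult.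
  by rewrite ltn_neqAle ge andbT eq_sym.
have ntt : (t <= t1) = false by lia.
have [rr|rr] := eqVneq (rho t) r; last first.
  have nP := rho_P t.
  exists (rho t); split=> //; first by rewrite /smain (negbTE nP) (negbTE rr).
    by move=> c; apply: spos_next_chain.
  move=> c cr; have -> : skey t (rho t) = rho t * K.+2.
    by rewrite skeyE (negbTE rr) (negbTE nP).
  rewrite skeyE ntt -/z.
  (* The order is rearranged only between [r] and [z], where by [rho_gap] no rank other than [r] is
     chosen any more. *)
  have lo : rho t < r \/ z < rho t.
    have [lt|ge] := ltnP (rho t) r; [by left | right].
    have gt : r < rho t by rewrite ltn_neqAle ge andbT eq_sym.
    suff : z <= (rho t).-1 by lia.
    by apply/bigmax_leqP => q qP; case: (@rho_gap t q (ltnW tt) qP) => ?; lia.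
  case: lo => [lo|hi]; case: ltnP => cq.
  - have -> : (c == r) = false by apply/negbTE; apply: contraTneq cq => ->; lia.
    have -> : (c \in P) = false by apply: contraTF cq => /P_above; lia.
    exact: mult.
  - have cq' : rho t < c by rewrite ltn_neqAle cq andbT eq_sym.
    case: eqP => _; first by apply: leq_trans (mult _ z _) _; [lia|rewrite leq_addr].
    case: ifP => cP; last by apply: mult.
    case: bact; last by apply: mult.
    by apply: leq_trans (mult _ _ lo) _; rewrite leq_addr.
  - case: eqP => _; first by apply: multS.
    case: ifP => cP; last by apply: mult.
    by case: bact; [apply: multS; rewrite ?levK //; lia | apply: mult].
  - have cq' : rho t < c by rewrite ltn_neqAle cq andbT eq_sym.
    have -> : (c == r) = false by apply/negbTE; apply: contraTneq cq' => ->; lia.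
    have -> : (c \in P) = false by apply: contraTF cq' => /zP; lia.
    exact: mult.
have [i iP [zi oi]] := exists_zero_bit (valid tt).
have sP := slot_in iP.
exists (slot i); split.
- by rewrite negb_and negbK sact_slot iP /bact tt zi orbT.
- exact: spos_next_bit.
- by rewrite rr; apply: ltnW; apply: P_above.
move=> c ci; have -> : skey t (slot i) = r * K.+2 + i.+1.
  by rewrite skeyE P_neq_r // sP lev_slot // /bact tt zi.
rewrite skeyE ntt -/z rr.
have iK : i.+1 < K.+2 by lia.
case: ltnP => cr.
  have -> : (c == r) = false by apply/negbTE; apply: contraTneq cr => ->; lia.
  have -> : (c \in P) = false by apply: contraTF cr => /P_above; lia.
  by apply: leq_trans (mult _ _ cr) _; rewrite leq_addr.
case: eqVneq => [_|cr']; first by apply: leq_trans (multS _ _ _ rz iK) _; rewrite leq_addr.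
have cgt : r < c by rewrite ltn_neqAle cr andbT eq_sym.
case: ifP => cP; last exact: multS.
case: ifP => ba; last exact: multS.
rewrite ltn_add2l ltnS; move: ba; rewrite /bact tt /= => zc.
rewrite ltn_neqAle leqNgt; apply/andP; split.
  by apply: contraNneq ci => ->; rewrite slot_lev.
by apply: contraNN zc => /oi.
Qed.

(** * The run on the scheduled program *)

Section Program.
Variables (n : nat) (Q : nat -> nat -> nat -> nat * nat) (flipped : bool).
Hypothesis size_n : 2 * horizon + 6 * K <= n.

Definition memory (t : nat) : nat := iter t (fun h => (Q K n h).2) 1.
Hypothesis rank_rho : forall t, 0 < (Q K n (memory t)).1 <= K /\
  rho t = (if flipped then K - (Q K n (memory t)).1 else (Q K n (memory t)).1.-1) :> nat.

Lemma card_vars : #|{: cvar slen}| <= n.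
Proof.
apply: leq_trans size_n; rewrite card_cvar.
apply: leq_trans (_ : \sum_(c < K) (2 * visits c horizon + 6) <= _).
  by apply: leq_sum => c _; have := slen_le c; lia.
by rewrite big_split /= -big_distrr /= sum_visits sum_nat_const card_ord [K * 6]mulnC.
Qed.

Lemma skey_imp t c (k := imp slen smain (spos t) (ssgn t) c) :
  k < (slen c).+4 /\ key_slot c (k != (slen c).+2) = skey t c.
Proof.
have pM := spos_le t c; rewrite /skey /k /imp.
have -> : smain c && ~~ act slen (spos t) (ssgn t) c = smain c && ~~ sact c t.
  by case mc: (smain c) => //=; rewrite sactE.
case: ifP => _ /=; first by rewrite eqxx; split=> //; lia.
have -> : spos t c + ~~ ssgn t c != (slen c).+2 by case: (ssgn t c); lia.
by split=> //; case: (ssgn t c); lia.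
Qed.

Lemma scheduled_lp : exists L : LP n, lp_m L <= n /\ LP_well_formed L /\
  forall T, simplex_run_length L Q T -> 2 ^ #|P| - 1 <= T.
Proof.
have [e e_inj e_mono] := @order_embedding _
  (fun v : cvar slen => key_slot (tag v) (nat_of_ord (tagged v) != (slen (tag v)).+2))
  flipped _ card_vars.
pose Mx := \max_c slen c.
have M_le c : slen c <= Mx by apply: leq_bigmax.
pose D : rat := (#|{: 'I_K}|%:R * 2 ^+ Mx.+2 + 1)%R.
have D_gt0 : (0 < D)%R.
  have : (0 <= #|{: 'I_K}|%:R * 2 ^+ Mx.+2 :> rat)%R.
    by apply: mulr_ge0; [apply: ler0n | apply: exprn_ge0].
  by rewrite /D => ?; lra.
pose kap : rat := (2 * D)^-1%R.
have kap_gt0 : (0 < kap)%R by rewrite invr_gt0 mulr_gt0.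
have kap_small : (kap * (#|{: 'I_K}|%:R * 2 ^+ Mx.+2 + 1) <= 1 / 2)%R.
  by rewrite -/D /kap invfM -mulrA mulVf ?gt_eqF // mulr1 mul1r.
pose L := chain_lp spar smain sdep kap e (spos 0).
exists L; split; [|split].
- rewrite /= (leq_trans _ card_vars) // card_cvar card_crow.
  by apply: leq_sum => c _; lia.
- apply: (chain_lp_well_formed slen_gt0 M_le spar_main sdep_par sdep_root smain_bit) => //.
  exact: spos_le.
move=> T [s [s0 [steps opt]]].
have impE t := improving_config slen_gt0 spar_main sdep_par sdep_root smain_bit
  kap_gt0 kap_small e_inj (spos 0) (spos_le t) (ssgnE t) (sproper t).
have step t := step_config slen_gt0 M_le spar_main sdep_par sdep_root smain_bit
  kap_gt0 kap_small e_inj (pos0 := spos 0) (spos_le t) (ssgnE t) (sproper t).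
(* The run follows the schedule while the counter cannot overflow, which [count_lt] guarantees. *)
have inv t : t <= T -> t < 2 ^ #|P| - 1 -> s t = (e @: config slen (spos t), memory t).
  elim: t => [|t IH] tT tP; first by rewrite s0.
  have st := IH (ltnW tT) (ltnW tP).
  have [|h' [c [kth mv]]] := step t Q (s t) (s t.+1) _ (steps t tT); first by rewrite st.
  have valid : t1 < t -> count t < 2 ^ #|P| - 1.
    by move=> /count_lt lt; apply: ltn_trans lt _; apply: ltnW.
  have [c0 [actc0 posc0 rc0 keyc0]] := target valid.
  pose g c := e (mkvar slen c (imp slen smain (spos t) (ssgn t) c)).
  have g_inj : injective g by move=> c1 c2 /e_inj/(congr1 tag).
  have g_mono c1 c2 : skey t c1 < skey t c2 -> if flipped then g c2 < g c1 else g c1 < g c2.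
    have [k1 <-] := skey_imp t c1; have [k2 <-] := skey_imp t c2.
    have := e_mono (mkvar slen c1 (imp slen smain (spos t) (ssgn t) c1))
      (mkvar slen c2 (imp slen smain (spos t) (ssgn t) c2)).
    by rewrite /= !inordK.
  move: kth h'; rewrite impE st /= card_ord => kth h'.
  have [/andP[Q0 QK] rhoE] := rank_rho t.
  have Ec : c = c0.
    apply: (kth_smallest_unique g_inj _ kth).
    have lt0 : rho t < K by apply: ltn_ord.
    case: (flipped) g_mono rhoE => g_mono rhoE.
      (* In the reversed order the predecessors of [c0] are the [K - rho t - 1] other components
         from [rho t] on. *)
      have -> : [set c' | g c' < g c0] = ~: [set c' : 'I_K | c' < rho t] :\ c0.
        apply/setP => c'; rewrite !inE; have [->|ne] := eqVneq c' c0; first by rewrite ltnn.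
        have := keyc0 _ ne; case: ltnP => _ /g_mono => [|->//].
        by move=> lt; apply/negbTE; rewrite -leqNgt ltnW.
      have := cardsD1 c0 (~: [set c' : 'I_K | c' < rho t]).
      rewrite !inE -leqNgt rc0; have := cardsC [set c' : 'I_K | c' < rho t].
      by rewrite card_ord card_ord_ltn ?(ltnW lt0) //; lia.
    have -> : [set c' | g c' < g c0] = [set c' : 'I_K | c' < rho t].
      apply/setP => c'; rewrite !inE; have [->|ne] := eqVneq c' c0.
        by rewrite ltnn ltnNge rc0.
      have := keyc0 _ ne; case: ltnP => _ /g_mono => [->//|].
      by move=> lt; apply/negbTE; rewrite -leqNgt ltnW.
    by rewrite card_ord_ltn ?(ltnW lt0).
  rewrite [s t.+1]surjective_pairing h'; congr (_, _).
  rewrite mv; last first.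
    by rewrite Ec; case mc: (smain c0) actc0 => //=; rewrite sactE.
  suff -> : config slen (move_pos (spos t) c (ssgn t c)) = config slen (spos t.+1) by [].
  by apply/setP => v; rewrite !inE posc0 Ec.
(* Every scheduled vertex has an improving variable, so the run cannot have stopped there. *)
rewrite leqNgt; apply/negP => TP; have sT := inv T (leqnn _) TP.
move: opt; rewrite sT /optimal_basis impE => /andP[_ /eqP/setP/(_ (e (mkvar slen r (imp slen smain (spos T) (ssgn T) r))))].
by rewrite inE => /negP; apply; apply: imset_f.
Qed.
End Program.

End Schedule.

(** * Superpolynomial lower bound *)

Lemma periodic_orbit (f : nat -> nat) (ell x : nat) :
  (forall h, 0 < f h <= ell)%N -> (0 < x <= ell)%N ->
  exists t0 p, [/\ (0 < p)%N, (t0 + p <= ell)%N &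
    forall t, (t0 <= t)%N -> iter (t + p) f x = iter t f x].
Proof.
move=> fell xell; have oell t : (0 < iter t f x <= ell)%N by case: t => [|t] /=; [exact: xell | exact: fell].
(* Pigeonhole: [ell.+1] iterates take at most [ell] values. *)
pose g (i : 'I_ell.+1) : nat := (iter i f x).-1.
have gell i : (g i < ell)%N by have := oell i; rewrite /g; lia.
have /injectivePn[i [j ij gij]] : ~~ injectiveb (fun i => Ordinal (gell i)).
  apply/negP => /injectiveP inj; have := max_card (mem (codom (fun i => Ordinal (gell i)))).
  by rewrite (card_codom inj) !card_ord ltnn.
have it_eq : iter i f x = iter j f x.
  by have := oell i; have := oell j; move/(congr1 val): gij; rewrite /= /g; lia.
wlog lt : i j ij gij it_eq / (i < j)%N.
  move=> H; case: (ltngtP i j) => [lt|lt|/val_inj E]; first exact: (H i j).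
    by apply: (H j i) => //; rewrite eq_sym.
  by rewrite E eqxx in ij.
exists i, (j - i)%N; split; [lia | have := ltn_ord j; lia |].
move=> t it; have -> : (t + (j - i) = (t - i) + j)%N by lia.
by rewrite -[in RHS](subnK it) !iterD it_eq.
Qed.

Lemma hard_lp n ell d (Q : nat -> nat -> nat -> nat * nat) :
  (forall k h, (0 < k)%N -> (1 <= (Q k n h).1 <= k)%N /\ (1 <= (Q k n h).2 <= ell)%N) ->
  (0 < ell)%N -> (ell < 2 ^ d)%N -> (12 * ell * d.+1 <= n)%N ->
  exists L : LP n, (lp_m L <= n)%N /\ LP_well_formed L /\
    forall T, simplex_run_length L Q T -> (2 ^ d - 1 <= T)%N.
Proof.
move=> HQ ell0 elld dn.
have d0 : (0 < d)%N by case: d elld {dn} => //; rewrite expn0; lia.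
(* The number of ranks that [slot_choice] needs when at most [ell] of them are visited. *)
pose K := (ell + ell.+1 * d)%N.
have K0 : (0 < K)%N by rewrite /K; lia.
pose mem t := iter t (fun h => (Q K n h).2) 1%N.
pose rank h := (Q K n h).1.
have rankK h : (0 < rank h <= K)%N by case: (HQ K h K0).
have rank_lt h : ((rank h).-1 < K)%N by have := rankK h; lia.
have mem_ell t : (0 < mem t <= ell)%N.
  by case: t => [|t] /=; [lia | case: (HQ K (mem t) K0)].
have [t0 [p [p0 t0p mem_per]]] : exists t0 p, [/\ (0 < p)%N, (t0 + p <= ell)%N &
    forall t, (t0 <= t)%N -> mem (t + p)%N = mem t].
  by apply: periodic_orbit => [h|]; [case: (HQ K h K0) | lia].
pose rho0 t : 'I_K := Ordinal (rank_lt (mem t)).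
have rho0_per t : (t0 <= t)%N -> rho0 (t + p)%N = rho0 t.
  by move=> tt; apply: val_inj; rewrite /= mem_per.
pose Vi : {set 'I_K} := [set Ordinal (rank_lt (nat_of_ord h).+1) | h in 'I_ell].
pose Cy : {set 'I_K} := [set rho0 (t0 + nat_of_ord i)%N | i in 'I_p].
have Vi_card : (#|Vi| <= ell)%N by rewrite -[leqRHS]card_ord leq_imset_card.
have rho_Vi t : rho0 t \in Vi.
  have lt : ((mem t).-1 < ell)%N by have := mem_ell t; lia.
  apply/imsetP; exists (Ordinal lt) => //; apply: val_inj => /=.
  by rewrite prednK //; case/andP: (mem_ell t).
have rho_Cy t : (t0 <= t)%N -> rho0 t \in Cy.
  move=> tt; have Et : t = (t0 + (t - t0) %% p + (t - t0) %/ p * p)%N.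
    by have := divn_eq (t - t0) p; lia.
  have -> : rho0 t = rho0 (t0 + (t - t0) %% p)%N.
    rewrite {1}Et; elim: ((t - t0) %/ p)%N => [|k IH]; first by rewrite mul0n addn0.
    by rewrite mulSn [(p + _)%N]addnC addnA rho0_per ?IH //; lia.
  by apply/imsetP; exists (Ordinal (ltn_pmod (t - t0) p0)).
have CyVi : Cy \subset Vi by apply/subsetP => q /imsetP[i _ ->].
have [|flipped [r0 [P0 [r0Cy P0d P0Vi P0gap]]]] :=
    slot_choice (rho_Cy t0 (leqnn _)) CyVi d0.
  by rewrite leq_add // leq_mul.
(* Reversing the ranks turns a gap before [r0] into a gap after it. *)
pose R (q : 'I_K) := if flipped then rev_ord q else q.
have RK : involutive R by rewrite /R => q; case: (flipped); rewrite ?rev_ordK.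
pose P := [set q | R q \in P0].
have PE : #|P| = #|P0|.
  rewrite -(card_imset P0 (inv_inj RK)); apply: eq_card => q; rewrite inE.
  by apply/idP/imsetP => [qP|[q' q'P ->]]; [exists (R q); rewrite ?RK | rewrite RK].
case/imsetP: r0Cy => i _ r0E.
pose t1 := (t0 + i)%N.
pose rho t := R (rho0 t).
have lo q : q \in P -> (R r0 < q)%N /\
    forall q', q' \in Cy -> (R q' <= R r0)%N \/ (q < R q')%N.
  rewrite inE /R => /P0gap; case: (flipped) => -[H1 H2]; split=> //.
    by move: H1 => /=; have := ltn_ord q; have := ltn_ord r0; lia.
  by move=> q' /H2 /=; have := ltn_ord q; have := ltn_ord r0; have := ltn_ord q'; lia.
have per_le : (per_period rho t1 p (R r0) <= p)%N.
  rewrite /per_period leq_subLR; elim: (p) => [|k IH]; first by rewrite !addn0.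
  by rewrite addnS visitsS; case: eqP; lia.
have rho_t1 : rho t1 = R r0 by rewrite /rho r0E.
have rho_per t : (t1 <= t)%N -> rho (t + p)%N = rho t.
  by move=> tt; rewrite /rho rho0_per //; rewrite /t1 in tt; lia.
(* [2 ^ lvl] divides the number of choices of [R r0] per period, which is positive and at most
   [p <= ell < 2 ^ d]. *)
have lvl_lt : (lvl rho t1 p (R r0) < #|P|)%N.
  apply: (@leq_trans d); last by rewrite PE.
  rewrite -(ltn_exp2l _ _ (ltnSn 1)); apply: leq_ltn_trans elld.
  apply: leq_trans (_ : p <= _)%N; last by lia.
  apply: leq_trans per_le; apply: dvdn_leq; last exact: pfactor_dvdnn.
  exact: per_period_gt0.
(* From [t1 < t0 + p <= ell] one gets [horizon <= 3 * ell]. *)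
have size_n : (2 * horizon t1 p + 6 * K <= n)%N.
  apply: leq_trans dn; rewrite /horizon /t1 /K; have := ltn_ord i; nia.
have P_above q : q \in P -> (R r0 < q)%N by case/lo.
have rho_P t : rho t \notin P.
  by rewrite inE /rho RK; apply/negP => tP; have := rho_Vi t; rewrite (disjointFr P0Vi tP).
have rho_gap t q : (t1 <= t)%N -> q \in P -> (rho t <= R r0)%N \/ (q < rho t)%N.
  by move=> tt /lo[_]; apply; apply: rho_Cy; rewrite /t1 in tt; lia.
have [|L [mL [wL runL]]] := scheduled_lp rho_t1 rho_per p0 P_above rho_P rho_gap lvl_lt
    (Q := Q) (flipped := flipped) size_n.
  move=> t; split; first exact: rankK.
  rewrite /rho /R /memory -/mem; case: (flipped) => //=.
  by have := rankK (mem t); rewrite -/(mem t) /rank; lia.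
exists L; split=> //; split=> // T /runL; apply: leq_trans.
by apply: leq_sub2r; rewrite leq_exp2l // PE.
Qed.

(** No rows, and padding variables only. It serves the values of [n] for which the counter would be
    too short. *)
Lemma trivial_lp n : exists L : LP n, (lp_m L <= n)%N /\ LP_well_formed L.
Proof.
pose e (v : void) : 'I_n := match v with end.
have e_inj : injective e by case.
pose a (w v : void) : rat := 0; pose b (w : void) : rat := 0; pose c (v : void) : rat := 0.
have bas : is_basis (labelled_lp e a b c finset.set0) (e @: finset.set0).
  by apply: labelled_basis; [| rewrite cards0 card_void | move=> y _ []].
exists (labelled_lp e a b c finset.set0); split; first by rewrite /= card_void.
apply: labelled_well_formed => //; last by exists b; case.
by have [x [_ _ ->]] := labelled_solution e_inj bas; case.
Qed.

Theorem theorem13 (ell : nat -> nat) (Hell : little_o_n_over_log ell)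
    (P : nat -> nat -> nat -> nat * nat) (HP : index_selector ell P) :
  exists LPs : forall n : nat, LP n,
    (forall n : nat, (lp_m (LPs n) <= n)%N /\ LP_well_formed (LPs n)) /\
    (forall k : nat, exists N : nat, forall n : nat, (N <= n)%N ->
       forall T : nat, simplex_run_length (LPs n) P T -> (n ^ k <= T)%N).
Proof.
have ell0 n : (0 < ell n)%N by case: (HP 1%N n 1%N isT) => _; lia.
(* When the quotient is positive, the largest [d] satisfying the size condition of [hard_lp]. *)
pose d n := (n %/ (12 * ell n)).-1.
have hard n : exists L : LP n, [/\ (lp_m L <= n)%N, LP_well_formed L &
    (ell n < 2 ^ d n)%N -> forall T, simplex_run_length L P T -> (2 ^ d n - 1 <= T)%N].
  have [elld|elld] := boolP (ell n < 2 ^ d n)%N; last first.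
    by have [L [mL wL]] := trivial_lp n; exists L.
  have d0 : (0 < d n)%N by case: (d n) elld (ell0 n) => //; rewrite expn0; lia.
  have dn : (12 * ell n * (d n).+1 <= n)%N.
    rewrite /d prednK; first by rewrite mulnC leq_divM.
    by move: d0; rewrite /d; lia.
  have [L [mL [wL runL]]] := hard_lp (fun k h => HP k n h) (ell0 n) elld dn.
  by exists L.
pose LPs n := ClassicalEpsilon.constructive_indefinite_description _ (hard n).
exists (fun n => proj1_sig (LPs n)); split=> [n|k].
  by case: (proj2_sig (LPs n)).
(* This gives [n %/ (12 * ell n)] at least [(2 * k + 6) * g], enough for [g.+1 * k.+1 <= d n] and
   hence for [n.+1 ^ k.+1 <= 2 ^ d n]. *)
have [N HN] := LittleO.little_o_nat Hell (12 * (2 * k + 6)).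
exists (maxn N 2) => n; rewrite geq_max => /andP[Nn n2] T run.
case: (proj2_sig (LPs n)) => _ _ runL.
have {}HN := HN n Nn; set g := trunc_log 2 n in HN.
have g1 : (0 < g)%N by rewrite /g trunc_log_gt0.
have ng : (n < 2 ^ g.+1)%N by apply: trunc_log_ltn.
have ell_n : (ell n <= n)%N.
  by apply: leq_trans HN; rewrite -mulnA mulnC -mulnA leq_pmulr // muln_gt0 g1; lia.
have gd : ((2 * k + 6) * g <= n %/ (12 * ell n))%N.
  rewrite leq_divRL; last by rewrite muln_gt0 ell0.
  by apply: leq_trans HN; lia.
have kd : (g.+1 * k.+1 <= d n)%N by rewrite /d; nia.
have nd : (n.+1 ^ k.+1 <= 2 ^ d n)%N.
  apply: (@leq_trans ((2 ^ g.+1) ^ k.+1)); first by rewrite leq_exp2r.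
  by rewrite -expnM leq_exp2l.
have elld : (ell n < 2 ^ d n)%N.
  apply: leq_trans nd.
  by apply: (@leq_trans n.+1); rewrite ?ltnS // expnS leq_pmulr // expn_gt0.
apply: leq_trans (runL elld T run).
have nk : (n ^ k < n.+1 ^ k.+1)%N.
  apply: (@leq_ltn_trans (n.+1 ^ k)); last by rewrite ltn_exp2l // ltnS ltnW.
  by case: (k) => [|k']; rewrite ?expn0 // leq_exp2r.
lia.
Qed.
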